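(* Let $f(z,t)$ be the solution of the chordal L\''owner equation $$\frac{df(z,t)}{dt}=\frac{2}{f(z,t)-\sqrt[3]{t}},\qquad f(z,0)=z,\qquad \operatorname{Im} z\ge 0,$$ which for all sufficiently small $t>0$ maps a slit domain $\mathbb H\setminus\gamma(t)$ onto $\mathbb H$. Let $\gamma_1(t)$ and $\gamma_2(t)$ be the two sides of the slit $\gamma(t)$, namely the preimages under the extended map $f(\cdot,t)$ of $I_1=[\sqrt[3]{t},f_1(0,t)]$ and $I_2=[f_2(0,t),\sqrt[3]{t}]$ respectively, and let $$m_k(t)=\omega\bigl(f^{-1}(i,t);\gamma_k(t),\mathbb H\setminus\gamma(t),t\bigr),\qquad k=1,2,$$ be the harmonic measure of $\gamma_k(t)$ at the point $f^{-1}(i,t)$ with respect to $\mathbb H\setminus\gamma(t)$. Then $$\lim_{t\to+0}\frac{m_1(t)}{m_2^2(t)}=6\pi .$$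
   Context: $\mathbb H$ is the upper half-plane. For $t>0$ small, the solution $f(\cdot,t)$ is a conformal map of $\mathbb H\setminus\gamma(t)$ onto $\mathbb H$, normalized by $f(z,t)=z+\frac{2t}{z}+O(z^{-2})$ as $z\to\infty$, where $\gamma(t)$ is a Jordan arc emanating from $0\in\mathbb R$ into $\mathbb H$; $f^{-1}(\cdot,t)$ denotes its inverse. The map $f(\cdot,t)$ extends continuously to the set of prime ends of $\mathbb H\setminus\gamma(t)$, sending the tip of $\gamma(t)$ to $\sqrt[3]{t}$. The functions $f_1(0,t)$ and $f_2(0,t)$ are the two real singular solutions, starting from $0$ at $t=0$, of $\frac{dy}{dt}=\frac{2}{y-\sqrt[3]{t}}$, $t>0$; they satisfy $f_2(0,t)<\sqrt[3]{t}<f_1(0,t)$ for small $t>0$ and have the asymptotics $f_1(0,t)=\sqrt[3]{t}+6\sqrt[3]{t^2}+o(\sqrt[3]{t^2})$ and $f_2(0,t)=-3\sqrt[3]{t^2}+o(\sqrt[3]{t^2})$ as $t\to+0$. The extended map sends the two sides of $\gamma(t)$ onto $I_1$ and $I_2$. The harmonic measure of $\gamma_k(t)$ is the value at $f^{-1}(i,t)$ of the harmonic function $\omega_k$ on $\mathbb H\setminus\gamma(t)$ (bounded, in the usual sense of harmonic measure) that extends continuously to the closure (in the sense of prime ends) except at the endpoints of $\gamma(t)$, with boundary values $1$ on the side $\gamma_k(t)$ and $0$ on $\mathbb R$ and on the other side of $\gamma(t)$. *)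

(* Defs.v *)
From HB Require Import structures.
From mathcomp Require Export all_boot all_order all_algebra.
From mathcomp Require Export all_classical all_reals all_analysis.
From mathcomp.real_closed Require Export complex.
Export numFieldNormedType.Exports.
Import Order.TTheory GRing.Theory Num.Theory.

Set Implicit Arguments.
Unset Strict Implicit.
Unset Printing Implicit Defensive.

Local Open Scope classical_set_scope.
Local Open Scope ring_scope.
Local Open Scope complex_scope.

(* R[i] seen as an abstract numeric field: this is what gives it the topology
   of its modulus and makes [derivable _ _ 1] complex differentiability. *)
Definition Cplx (R : realType) : numClosedFieldType := R[i].

(* On [0, +oo[ this is the real cube root; it is only used there. *)
Definition cbrt {R : realType} (t : R) : R := t `^ 3^-1.

Definition upper_half_plane (R : realType) : set (Cplx R) :=
  [set z | 0 < complex.Im z].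

(* y solves dy/ds = 2 / (y - lambda) on [0, t] with y(0) = z.  The derivative
   of a function of a real variable is taken on real and imaginary parts. *)
Definition loewner_solution {R : realType} (lambda : R -> R) (t : R)
    (z : Cplx R) (y : R -> Cplx R) : Prop :=
  [/\ y 0 = z,
      {within `[0, t], continuous y}
    & forall s, 0 < s < t ->
        let v : Cplx R := 2 / (y s - (lambda s)%:C) in
        [/\ y s != (lambda s)%:C,
            is_derive s 1 (fun r => complex.Re (y r)) (complex.Re v)
          & is_derive s 1 (fun r => complex.Im (y r)) (complex.Im v)]].

(* A real solution on ]0, T[ issued from the singular point lambda(0) = 0. *)
Definition singular_solution {R : realType} (lambda : R -> R) (T : R)
    (y : R -> R) : Prop :=
  y s @[s --> 0^'+] --> (0 : R) /\
  forall s, 0 < s < T ->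
    y s != lambda s /\ is_derive s 1 y (2 / (y s - lambda s)).

(* c parametrizes, over [0, 1], a Jordan arc emanating from 0 into the upper
   half-plane; its tip is c 1. *)
Definition slit_arc {R : realType} (c : R -> Cplx R) : Prop :=
  [/\ {within `[0, 1], continuous c},
      {in `[0, 1] &, injective c},
      c 0 = 0
    & forall s, 0 < s <= 1 -> @upper_half_plane R (c s)].

Definition arc_image {R : realType} (c : R -> Cplx R) : set (Cplx R) :=
  c @` `[0, 1].

Definition slit_domain {R : realType} (c : R -> Cplx R) : set (Cplx R) :=
  @upper_half_plane R `\` arc_image c.

Definition conformal_onto {R : realType} (D E : set (Cplx R))
    (f g : Cplx R -> Cplx R) : Prop :=
  [/\ forall z, D z -> derivable f z 1,
      forall z, D z -> E (f z) /\ g (f z) = z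
    & forall w, E w -> D (g w) /\ f (g w) = w].

(* Spherical (chordal) distance between two finite points. *)
Definition chordal {R : realType} (z w : Cplx R) : R :=
  2 * Normc.normc (z - w) /
  (Num.sqrt (1 + Normc.normc z ^+ 2) * Num.sqrt (1 + Normc.normc w ^+ 2)).

(* Closed Jordan arcs lying in D except for their two endpoints, which are
   on the boundary of D.  Only finite endpoints are considered: the arcs of a
   null chain have disjoint closures, so at most one of them could end at
   infinity, and it can be dropped from the chain. *)
Definition crosscut {R : realType} (D : set (Cplx R)) (c : R -> Cplx R) : Prop :=
  [/\ {within `[0, 1], continuous c},
      {in `[0, 1] &, injective c},
      forall s, 0 < s < 1 -> D (c s)
    & ~ D (c 0) /\ ~ D (c 1)].

Definition is_component {R : realType} (A V : set (Cplx R)) : Prop :=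
  exists2 z, A z & V = connected_component A z.

Definition null_chain {R : realType} (D : set (Cplx R))
    (c : nat -> R -> Cplx R) (V : nat -> set (Cplx R)) : Prop :=
  [/\ forall n, crosscut D (c n),
      forall n, is_component (D `\` arc_image (c n)) (V n),
      forall n, V n.+1 `<=` V n,
      forall m n, m != n -> arc_image (c m) `&` arc_image (c n) = set0
    & forall e : R, 0 < e -> \forall n \near \oo,
        forall a b, a \in `[0, 1] -> b \in `[0, 1] ->
          chordal (c n a) (c n b) < e].

(* A prime end of a simply connected domain D (in the sense of Caratheodory)
   is a class of null chains, two chains being equivalent when every V n
   contains some V' m and conversely, that is, when (V n) and (V' n) generate
   the same filter.  We represent the prime end by that filter; thus
   [g @ F --> l] says that g(z) -> l as z tends to the prime end F. *)
Definition prime_end {R : realType} (D : set (Cplx R))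
    (F : set_system (Cplx R)) : Prop :=
  exists c V, null_chain D c V /\ F = [set A | exists n, V n `<=` A].

(* Neighbourhoods, within the upper half-plane, of its boundary point x
   ([Some x]) or infinity ([None]). *)
Definition half_plane_end {R : realType} (e : option R) : set_system (Cplx R) :=
  within (@upper_half_plane R)
    (if e is Some x then nbhs (x%:C : Cplx R)
     else [set A | exists M : R, forall z : Cplx R, M < Normc.normc z -> A z]).

(* f, a bijection from D onto the upper half-plane with inverse g, extends to
   a homeomorphism from the set of prime ends of D onto the extended real
   line. *)
Definition extends_to_prime_ends {R : realType} (D : set (Cplx R))
    (f g : Cplx R -> Cplx R) : Prop :=
  [/\ forall F, prime_end D F -> exists e : option R, f @ F --> half_plane_end e,
      forall e : option R, exists2 F, prime_end D F & f @ F --> half_plane_end e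
    & forall F (e : option R), prime_end D F -> f @ F --> half_plane_end e ->
        g @ half_plane_end e --> F].

(* Preimage of a set of real points under the map extended to prime ends. *)
Definition prime_end_preimage {R : realType} (D : set (Cplx R))
    (f : Cplx R -> Cplx R) (I : set R) : set (set_system (Cplx R)) :=
  [set F | prime_end D F /\ exists2 x, I x & f @ F --> (x%:C : Cplx R)].

Definition prime_ends_over {R : realType} (D : set (Cplx R)) (p : Cplx R) :
    set (set_system (Cplx R)) :=
  [set F | prime_end D F /\ F --> p].

Definition dRe {R : realType} (u : Cplx R -> R) (z : Cplx R) : R :=
  'D_1 (fun x : R => u (x +i* complex.Im z)) (complex.Re z).

Definition dIm {R : realType} (u : Cplx R -> R) (z : Cplx R) : R :=
  'D_1 (fun y : R => u (complex.Re z +i* y)) (complex.Im z).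

Definition C1_on {R : realType} (D : set (Cplx R)) (u : Cplx R -> R) : Prop :=
  forall z, D z ->
    [/\ derivable (fun x : R => u (x +i* complex.Im z)) (complex.Re z) 1,
        derivable (fun y : R => u (complex.Re z +i* y)) (complex.Im z) 1,
        {for z, continuous (dRe u)}
      & {for z, continuous (dIm u)}].

Definition harmonic_on {R : realType} (D : set (Cplx R)) (u : Cplx R -> R) :
    Prop :=
  [/\ C1_on D u, C1_on D (dRe u), C1_on D (dIm u)
    & forall z, D z -> dRe (dRe u) z + dIm (dIm u) z = 0].

(* m is the value at z0 of the bounded harmonic function on D with boundary
   values 1 on the set E of prime ends and 0 at the other ones; no boundary
   value is required at the prime ends in X. *)
Definition is_harmonic_measure {R : realType} (D : set (Cplx R))
    (E X : set (set_system (Cplx R))) (z0 : Cplx R) (m : R) : Prop :=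
  exists w : Cplx R -> R,
    [/\ harmonic_on D w,
        exists M : R, forall z, D z -> `|w z| <= M,
        forall F, prime_end D F -> ~ X F -> w @ F --> (\1_E F : R)
      & m = w z0].

(* Main.v *)
(* Transport the harmonic measures to the half-plane by f^{-1}(., t): bounded
   harmonic functions there are determined by their boundary values off finitely
   many points, so m_1 and m_2 are 1/pi times the angles under which I_1 and I_2
   are seen from i, namely
     m_1 = (atan f_1 - atan t^{1/3}) / pi,  m_2 = (atan t^{1/3} - atan f_2) / pi.
   With s = t^{1/3}, comparing the singular solutions with the barriers
   s + k s^2 gives f_1 - s ~ 6 s^2 and f_2 = O(s^2), hence m_1 / m_2^2 -> 6 pi.

   Harmonicity of the transported function does not use complex analysis: if
   the y_j are Loewner trajectories ending at the points y_0 + r i^j, then the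
   differences d_j = y_j - y_0 satisfy sum_j d_j = O(r^3) and
   sum_j d_j^2 = O(r^3) at all times by Gronwall's inequality, and Taylor's
   formula for a harmonic w only involves d_j and d_j^2 up to o(r^2). *)
Require Import Defs.
From mathcomp Require Import ring lra.
Import Order.TTheory GRing.Theory Num.Theory.
Set Implicit Arguments.
Unset Strict Implicit.
Unset Printing Implicit Defensive.
Local Open Scope classical_set_scope.
Local Open Scope ring_scope.
Local Open Scope complex_scope.

(** * Mean value property on crosses *)

Definition cross_diff {R : realType} (U : R -> R -> R) (x y r : R) : R :=
  U (x + r) y + U (x - r) y + U x (y + r) + U x (y - r) - 4 * U x y.

(* Harmonicity in the weak form of a second-order mean value property on the
   vertices of a small cross: it asks for no derivative, so it can be checked for
   the pull-back of a harmonic function by the inverse Loewner flow directly on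
   the differential equation, and it suffices for a maximum principle. *)
Definition mean_harmonic_at {R : realType} (U : R -> R -> R) (x y : R) : Prop :=
  forall e : R, 0 < e ->
    \forall r \near 0^'+, `|cross_diff U x y r| <= e * r ^+ 2.

Lemma mean_harmonic_atD {R : realType} (U V : R -> R -> R) (x y : R) :
  mean_harmonic_at U x y -> mean_harmonic_at V x y ->
  mean_harmonic_at (fun a b => U a b + V a b) x y.
Proof.
move=> hU hV e e0; have e20 : 0 < e / 2 by lra.
near=> r.
have hu : `|cross_diff U x y r| <= e / 2 * r ^+ 2 by near: r; exact: hU.
have hv : `|cross_diff V x y r| <= e / 2 * r ^+ 2 by near: r; exact: hV.
rewrite (_ : cross_diff _ _ _ _ = cross_diff U x y r + cross_diff V x y r).
  by apply: (le_trans (ler_normD _ _)); lra.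
by rewrite /cross_diff; ring.
Unshelve. all: by end_near. Qed.

Lemma mean_harmonic_atZ {R : realType} (k : R) (U : R -> R -> R) (x y : R) :
  mean_harmonic_at U x y -> mean_harmonic_at (fun a b => k * U a b) x y.
Proof.
move=> hU e e0; have k0 : 0 < `|k| + 1 by rewrite ltr_wpDl.
near=> r.
have hu : `|cross_diff U x y r| <= e / (`|k| + 1) * r ^+ 2.
  by near: r; apply: hU; exact: divr_gt0.
rewrite (_ : cross_diff _ _ _ _ = k * cross_diff U x y r); last first.
  by rewrite /cross_diff; ring.
rewrite normrM; apply: (@le_trans _ _ ((`|k| + 1) * (e / (`|k| + 1) * r ^+ 2))).
  by apply: ler_pM => //; rewrite lerDl.
by rewrite mulrA [X in X * _]mulrC divfK ?gt_eqF.
Unshelve. all: by end_near. Qed.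

Lemma mean_harmonic_atB {R : realType} (U V : R -> R -> R) (x y : R) :
  mean_harmonic_at U x y -> mean_harmonic_at V x y ->
  mean_harmonic_at (fun a b => U a b - V a b) x y.
Proof.
move=> hU hV.
rewrite (_ : (fun _ _ => _) = fun a b => U a b + -1 * V a b).
  by apply: mean_harmonic_atD => //; exact: mean_harmonic_atZ.
by apply/funext => a; apply/funext => b; rewrite mulN1r.
Qed.

Lemma mean_harmonic_at_sum {R : realType} (I : Type) (s : seq I)
    (U : I -> R -> R -> R) (x y : R) :
  (forall i, mean_harmonic_at (U i) x y) ->
  mean_harmonic_at (fun a b => \sum_(i <- s) U i a b) x y.
Proof.
move=> hU; elim: s => [|i s ih].
  move=> e e0; near=> r.
  rewrite /cross_diff !big_nil !addr0 mulr0 subr0 normr0.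
  by rewrite mulr_ge0 ?sqr_ge0// ltW.
rewrite (_ : (fun _ _ => _) = fun a b => U i a b + \sum_(j <- s) U j a b).
  exact: mean_harmonic_atD.
by apply/funext => a; apply/funext => b; rewrite big_cons.
Unshelve. all: by end_near. Qed.

(* The four points c + r i^j satisfy prod_j (c + r i^j) = c^4 - r^4, so the
   averages of log |c| are exact up to order r^4. *)
Lemma mean_harmonic_at_ln {R : realType} (p q x y : R) : 0 < y + q ->
  mean_harmonic_at (fun a b => ln ((a - p) ^+ 2 + (b + q) ^+ 2)) x y.
Proof.
move=> b0 e e0; set b := y + q in b0; set a := x - p.
pose n := a ^+ 2 + b ^+ 2; pose K := 1 + 2 * n ^+ 2.
have n0 : 0 < n by rewrite /n ltr_wpDl ?sqr_ge0// exprn_gt0.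
have n40 : 0 < n ^+ 4 by exact: exprn_gt0.
have K0 : 0 < K by rewrite /K ltr_wpDr// mulr_ge0// sqr_ge0.
near=> r.
have r0 : 0 < r by near: r; exact: nbhs_right_gt.
have r1 : r < 1 by near: r; exact: nbhs_right_lt.
have rn : r < n ^+ 4 / (2 * K).
  by near: r; apply: nbhs_right_lt; rewrite divr_gt0// mulr_gt0.
have re : r < e * n ^+ 4 / (2 * K).
  by near: r; apply: nbhs_right_lt; rewrite divr_gt0// mulr_gt0.
have rb : r < b by near: r; exact: nbhs_right_lt.
rewrite ltr_pdivlMr ?mulr_gt0// in rn; rewrite ltr_pdivlMr ?mulr_gt0// in re.
have r2 : r ^+ 2 <= r by rewrite expr2 ler_piMl// ltW.
have r20 : 0 < r ^+ 2 by exact: exprn_gt0.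
have r4E : r ^+ 4 = r ^+ 2 * r ^+ 2 by rewrite -exprD.
have r4 : r ^+ 4 <= r ^+ 2 by rewrite r4E ler_piMl ?ltW//; lra.
pose P := n ^+ 4 + r ^+ 4 * (r ^+ 4 - 2 * n ^+ 2 + 16 * (a * b) ^+ 2).
have Pn : `|P - n ^+ 4| <= r ^+ 4 * K.
  have -> : P - n ^+ 4 = r ^+ 4 * (r ^+ 4 - 2 * n ^+ 2 + 16 * (a * b) ^+ 2).
    by rewrite /P; ring.
  have r40 : 0 < r ^+ 4 by exact: exprn_gt0.
  rewrite normrM (gtr0_norm r40) ler_pM2l// ler_norml /K.
  have : 0 <= (a ^+ 2 - b ^+ 2) ^+ 2 by exact: sqr_ge0.
  have : 0 <= (a * b) ^+ 2 by exact: sqr_ge0.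
  have : 0 <= r ^+ 4 by rewrite exprn_ge0 ?ltW.
  rewrite /n => h1 h2 h3; apply/andP; split; lra.
have rK : r ^+ 4 * K <= r ^+ 2 * K by rewrite ler_pM2r.
have rK2 : r ^+ 2 * K <= r * K by rewrite ler_pM2r.
move: (Pn); rewrite ler_norml => /andP[Pn1 Pn2].
have P0 : n ^+ 4 / 2 < P by lra.
have -> : cross_diff (fun a0 b0 => ln ((a0 - p) ^+ 2 + (b0 + q) ^+ 2)) x y r
    = ln (P / n ^+ 4).
  have h (c d : R) : 0 < d -> c ^+ 2 + d ^+ 2 \is Num.pos.
    by move=> d0; rewrite posrE ltr_wpDl ?sqr_ge0// exprn_gt0.
  have br : 0 < b + r by lra.
  have br' : 0 < b - r by lra.
  rewrite ln_div ?posrE//; last lra.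
  rewrite lnXn// /cross_diff.
  rewrite (_ : P = ((a + r) ^+ 2 + b ^+ 2) * ((a - r) ^+ 2 + b ^+ 2)
    * (a ^+ 2 + (b + r) ^+ 2) * (a ^+ 2 + (b - r) ^+ 2)); last first.
    by rewrite /P /n; ring.
  rewrite !lnM ?h ?rpredM ?h//.
  rewrite /n /a /b !(addrAC _ _ q) !(addrAC x _ (- p)) -[ln _ *+ 4]mulr_natl.
  by [].
have nP : 0 < P / n ^+ 4 by rewrite divr_gt0//; lra.
rewrite ler_norml; apply/andP; split; last first.
  rewrite (_ : P / n ^+ 4 = 1 + (P - n ^+ 4) / n ^+ 4); last first.
    by rewrite mulrBl divff ?gt_eqF// addrC subrK.
  apply: (@le_trans _ _ ((P - n ^+ 4) / n ^+ 4)).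
    apply: le_ln1Dx; rewrite ltr_pdivlMr//; lra.
  rewrite ler_pdivrMr//; apply: (le_trans Pn2).
  rewrite r4E.
  rewrite -[leLHS]mulrA (_ : e * r ^+ 2 * n ^+ 4 = r ^+ 2 * (e * n ^+ 4)); last by ring.
  rewrite ler_pM2l//; lra.
rewrite lerNl -lnV ?posrE// invf_div.
rewrite (_ : n ^+ 4 / P = 1 + (n ^+ 4 - P) / P); last first.
  by rewrite mulrBl divff ?gt_eqF 1?addrC ?subrK//; lra.
have P00 : 0 < P by lra.
apply: (@le_trans _ _ ((n ^+ 4 - P) / P)).
  apply: le_ln1Dx; rewrite ltr_pdivlMr//; lra.
rewrite ler_pdivrMr//; apply: (@le_trans _ _ (r ^+ 4 * K)); first lra.
apply: (@le_trans _ _ (e * r ^+ 2 * (n ^+ 4 / 2))); last first.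
  by rewrite ler_pM2l ?mulr_gt0// ltW.
rewrite (_ : e * r ^+ 2 * (n ^+ 4 / 2) = r ^+ 2 * (e * (n ^+ 4 / 2))); last by ring.
rewrite r4E -[leLHS]mulrA ler_pM2l//; lra.
Unshelve. all: by end_near. Qed.

Lemma cross_diff_strict {R : realType} (x y r : R) : 0 < y -> 0 < r -> r < y ->
  2 * r ^+ 2 / (1 + y) ^+ 3 <= cross_diff (fun _ b => (1 + b)^-1) x y r.
Proof.
move=> y0 r0 ry; rewrite /cross_diff.
rewrite (_ : _ - _ = 2 * r ^+ 2 / ((1 + y) * ((1 + y) ^+ 2 - r ^+ 2))).
  have h : 0 < (1 + y) ^+ 2 - r ^+ 2 by nra.
  rewrite ler_pM2l ?mulr_gt0 ?exprn_gt0// lef_pV2 ?posrE ?mulr_gt0 ?exprn_gt0//; try lra.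
  rewrite exprS ler_pM2l; last lra.
  by rewrite gerBl sqr_ge0.
by field; rewrite !gt_eqF//; nra.
Qed.

Lemma near_box {R : realType} (x y d : R) : 0 < d ->
  \forall z \near (x, y), `|z.1 - x| < d /\ `|z.2 - y| < d.
Proof.
move=> d0; exists (ball x d, ball y d); first by split; exact: nbhsx_ballx.
by move=> [a b] [/=]; rewrite /ball/= !(distrC x, distrC y).
Qed.

(** * A maximum principle on the half-plane *)

Section maximum_principle.
Context {R : realType}.
Implicit Types (V : R -> R -> R) (X : seq R).

Let barrier X (x y : R) : R :=
  \sum_(p <- X) (ln ((x - p) ^+ 2 + (y + 1) ^+ 2) -
                 ln ((x - p) ^+ 2 + (y + 0) ^+ 2)).

Let sumsqr_gt0 (a b : R) : 0 < b -> 0 < a ^+ 2 + b ^+ 2.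
Proof. by move=> b0; rewrite ltr_wpDl ?sqr_ge0// exprn_gt0. Qed.

Let barrier_term_ge0 (p x y : R) : 0 < y ->
  0 <= ln ((x - p) ^+ 2 + (y + 1) ^+ 2) - ln ((x - p) ^+ 2 + (y + 0) ^+ 2).
Proof.
move=> y0; rewrite subr_ge0 ler_ln ?posrE ?sumsqr_gt0 ?addr0//; last lra.
by rewrite lerD2l ler_sqr ?nnegrE; lra.
Qed.

Let barrier_ge0 X (x y : R) : 0 < y -> 0 <= barrier X x y.
Proof. by move=> y0; apply: sumr_ge0 => p _; exact: barrier_term_ge0. Qed.

Let barrier_mean_harmonic X (x y : R) : 0 < y -> mean_harmonic_at (barrier X) x y.
Proof.
move=> y0; apply: mean_harmonic_at_sum => p.
by apply: mean_harmonic_atB; apply: mean_harmonic_at_ln; lra.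
Qed.

Let continuous_ln_sumsqr (p q x y : R) : 0 < y + q ->
  {for (x, y), continuous (fun z : R * R => ln ((z.1 - p) ^+ 2 + (z.2 + q) ^+ 2))}.
Proof.
move=> yq; apply: (@continuous_comp _ _ _
  (fun z : R * R => (z.1 - p) ^+ 2 + (z.2 + q) ^+ 2) (@ln R)); last first.
  by apply: continuous_ln; exact: sumsqr_gt0.
apply: cvgD; rewrite !expr2; apply: cvgM;
  by apply: cvgD; [first [exact: cvg_fst|exact: cvg_snd]|exact: cvg_cst].
Qed.

Let barrier_continuous X (x y : R) : 0 < y ->
  {for (x, y), continuous (fun z : R * R => barrier X z.1 z.2)}.
Proof.
move=> y0; elim: X => [|p X ih].
  rewrite (_ : (fun _ => _) = cst 0); first exact: cvg_cst.
  by apply/funext => z; rewrite /barrier big_nil.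
rewrite (_ : (fun _ => _) = fun z : R * R =>
  ln ((z.1 - p) ^+ 2 + (z.2 + 1) ^+ 2) - ln ((z.1 - p) ^+ 2 + (z.2 + 0) ^+ 2)
  + barrier X z.1 z.2); last by apply/funext => z; rewrite /barrier big_cons.
apply: cvgD ih; apply: cvgB; apply: continuous_ln_sumsqr; lra.
Qed.

Let barrier_large X (p K : R) : p \in X ->
  exists2 d : R, 0 < d & forall x y : R, 0 < y -> `|x - p| < d -> y < d ->
    K <= barrier X x y.
Proof.
move=> pX; exists (expR (- `|K| - 1) / 2); first by rewrite divr_gt0// expR_gt0.
set c := expR _ => x y y0 xp yc.
have c0 : 0 < c by exact: expR_gt0.
have c1 : c < 1 by rewrite expR_lt1; have := normr_ge0 K; lra.
apply: (@le_trans _ _ (ln ((x - p) ^+ 2 + (y + 1) ^+ 2) -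
                 ln ((x - p) ^+ 2 + (y + 0) ^+ 2))); last first.
  rewrite /barrier (big_rem p)//= lerDl.
  by apply: sumr_ge0 => q _; exact: barrier_term_ge0.
have h1 : 0 <= ln ((x - p) ^+ 2 + (y + 1) ^+ 2).
  by apply: ln_ge0; have := sqr_ge0 (x - p); nra.
suff : ln ((x - p) ^+ 2 + (y + 0) ^+ 2) <= - `|K| - 1.
  by have := ler_norm K; lra.
rewrite -(expRK (- `|K| - 1)) ler_ln ?posrE ?expR_gt0 ?sumsqr_gt0 ?addr0//.
rewrite -/c; have : (x - p) ^+ 2 <= (c / 2) ^+ 2.
  by rewrite -real_normK ?num_real// ler_sqr ?nnegrE//; lra.
have : y ^+ 2 <= (c / 2) ^+ 2 by rewrite ler_sqr ?nnegrE; lra.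
nra.
Qed.

Lemma cross_diff_at_max V (x0 y0 : R) : 0 < y0 ->
  (forall x y : R, 0 < y -> V x y <= V x0 y0) ->
  \forall r \near 0^'+, cross_diff V x0 y0 r <= 0.
Proof.
move=> y00 Vmax; near=> r; rewrite /cross_diff.
have r0 : 0 < r by near: r; exact: nbhs_right_gt.
have ry : r < y0 by near: r; exact: nbhs_right_lt.
have h1 := Vmax (x0 + r) y0 y00; have h2 := Vmax (x0 - r) y0 y00.
have h3 : V x0 (y0 + r) <= V x0 y0 by apply: Vmax; lra.
have h4 : V x0 (y0 - r) <= V x0 y0 by apply: Vmax; lra.
lra.
Unshelve. all: by end_near. Qed.

Let strictly_submean_no_max V (e x0 y0 : R) : 0 < e -> 0 < y0 ->
  mean_harmonic_at V x0 y0 ->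
  (forall x y : R, 0 < y ->
     V x y + e * (1 + y)^-1 <= V x0 y0 + e * (1 + y0)^-1) -> False.
Proof.
move=> e0 y00 Vh Vmax.
have hmax := cross_diff_at_max y00 Vmax.
have d0 : 0 < e / (1 + y0) ^+ 3 by rewrite divr_gt0// exprn_gt0//; lra.
suff /filter_ex[] : \forall r \near (0 : R)^'+, False by [].
near=> r.
have r0 : 0 < r by near: r; exact: nbhs_right_gt.
have ry : r < y0 by near: r; exact: nbhs_right_lt.
have h1 : cross_diff (fun x y => V x y + e * (1 + y)^-1) x0 y0 r <= 0.
  by near: r.
have h2 : `|cross_diff V x0 y0 r| <= e / (1 + y0) ^+ 3 * r ^+ 2.
  by near: r; exact: Vh.
have := cross_diff_strict x0 y00 r0 ry.
rewrite -(ler_pM2l e0) => h3.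
have h4 : 0 < e / (1 + y0) ^+ 3 * r ^+ 2 by rewrite mulr_gt0// exprn_gt0.
have h5 : cross_diff (fun x y => V x y + e * (1 + y)^-1) x0 y0 r =
  cross_diff V x0 y0 r + e * cross_diff (fun _ b => (1 + b)^-1) x0 y0 r.
  by rewrite /cross_diff; ring.
move: h2; rewrite ler_norml => /andP[h2 _]; lra.
Unshelve. all: by end_near. Qed.

(* A Phragmen-Lindelof maximum principle: boundary values may fail to exist at
   the finitely many points of [X], where the harmonic barrier
   2 log |(z - p + i) / (z - p)| tends to infinity. *)
Lemma half_plane_maximum_principle V X :
  (forall x y : R, 0 < y ->
     {for (x, y), continuous (fun z : R * R => V z.1 z.2)}) ->
  (forall x y : R, 0 < y -> mean_harmonic_at V x y) ->
  (exists M, forall x y : R, 0 < y -> V x y <= M) ->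
  (forall p, p \notin X -> forall e : R, 0 < e ->
     exists2 d : R, 0 < d & forall x y : R, 0 < y -> `|x - p| < d -> y < d ->
       V x y <= e) ->
  (forall e : R, 0 < e -> exists K : R, forall x y : R, 0 < y -> K < `|x| \/ K < y ->
     V x y <= e) ->
  forall x y : R, 0 < y -> V x y <= 0.
Proof.
move=> Vc Vh [M VM] Vbd Vinf a b b0; rewrite leNgt; apply/negP => Vab.
have B0 := barrier_ge0 X a b0.
pose e := V a b / (barrier X a b + 3).
have e0 : 0 < e by rewrite divr_gt0//; lra.
have eV : e * (barrier X a b + 3) = V a b by rewrite divfK// gt_eqF//; lra.
pose W (x y : R) := V x y - e * barrier X x y.
pose P (x y : R) := W x y + e * (1 + y)^-1.
pose Q (z : R * R) := if 0 < z.2 then Num.max (P z.1 z.2) (2 * e) else 2 * e.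
have inv_bd (y : R) : 0 < y -> 0 < (1 + y)^-1 <= 1.
  move=> y0; have y1 : 0 < 1 + y by lra.
  by rewrite invr_gt0 y1/= invf_le1// lerDl ltW.
have PV (x y : R) : 0 < y -> P x y <= V x y + e.
  move=> y0; rewrite /P /W; have := barrier_ge0 X x y0.
  have /andP[_ h] := inv_bd _ y0; nra.
have Pab : 2 * e < P a b.
  rewrite /P /W; have /andP[h _] := inv_bd _ b0.
  have : 0 < e * (1 + b)^-1 by rewrite mulr_gt0.
  lra.
have Wc (x y : R) : 0 < y -> {for (x, y), continuous (fun z : R * R => P z.1 z.2)}.
  move=> y0; apply: cvgD.
    apply: cvgB; first exact: Vc.
    by apply: cvgM; [exact: cvg_cst|exact: barrier_continuous].
  apply: cvgM; first exact: cvg_cst.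
  apply: cvgV; first by rewrite gt_eqF//=; lra.
  by apply: cvgD; [exact: cvg_cst|exact: cvg_snd].
have Qc : continuous Q.
  move=> [x y]; have [y0|y0] := ltP 0 y.
    rewrite /continuous_at /Q/= y0.
    apply: (@cvg_trans _ (Num.max (P z.1 z.2) (2 * e) @[z --> (x, y)])).
      apply: near_eq_cvg; near=> z; rewrite ifT//.
      have [_] : `|z.1 - x| < y /\ `|z.2 - y| < y by near: z; exact: near_box.
      by rewrite ltr_norml; lra.
    have := @continuous_max _ _ (fun z : R * R => P z.1 z.2) (cst (2 * e)) (x, y)
      (Wc _ _ y0) (cvg_cst _).
    by apply; exact: nbhs_filter.
  suff [d d0 hd] : exists2 d : R, 0 < d & forall x' y' : R, 0 < y' ->
      `|x' - x| < d -> y' < d -> P x' y' <= 2 * e.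
    have Q0 : Q (x, y) = 2 * e by rewrite /Q/= ltNge y0.
    rewrite /continuous_at Q0.
    apply: (@cvg_trans _ ((fun=> 2 * e) z @[z --> (x, y)])); last first.
      move=> S /nbhs_singleton hS.
      by apply: (@filterE _ (nbhs (x, y))) => z; exact: hS.
    apply: near_eq_cvg; near=> z; rewrite /Q; case: ifPn => // z0.
    have [z1 z2] : `|z.1 - x| < d /\ `|z.2 - y| < d by near: z; exact: near_box.
    by rewrite max_r//; apply: hd => //; move: z2; rewrite ltr_norml; lra.
  have [xX|xX] := boolP (x \in X).
    have [d d0 hd] := barrier_large (`|M| / e) xX; exists d => // x' y' y'0 h1 h2.
    have := hd _ _ y'0 h1 h2; rewrite ler_pdivrMr// /P /W.
    have := VM x' y' y'0; have /andP[h3 h4] := inv_bd _ y'0.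
    have := ler_norm M; nra.
  have [d d0 hd] := Vbd _ xX _ e0; exists d => // x' y' y'0 h1 h2.
  by have := hd _ _ y'0 h1 h2; have := PV x' y' y'0; lra.
have [K hK] := Vinf _ e0.
pose L := `|K| + `|a| + b.
have Lb : [/\ K <= L, `|a| <= L & b <= L].
  have := ler_norm K; have := normr_ge0 a; have := normr_ge0 K; rewrite /L.
  by split; lra.
case: Lb => KL aL bL.
pose A : set (R * R) := `[- L, L]%classic `*` `[0, L]%classic.
have Aab : A (a, b).
  by split => /=; rewrite in_itv/= ?(ltW b0) -?ler_norml.
have cA : compact A by apply: compact_setX; exact: segment_compact.
have [] := @compact_EVT_max _ _ Q A _ cA; first by exists (a, b).
  exact: continuous_subspaceT.
move=> [x0 y0] _ Qmax.
have Qab : 2 * e < Q (x0, y0).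
  apply: lt_le_trans (Qmax (a, b) _); last exact: mem_set.
  by rewrite /Q/= b0 lt_max Pab.
have y00 : 0 < y0 by move: Qab; rewrite /Q/=; case: ifP; rewrite ?ltxx.
have QP : Q (x0, y0) = P x0 y0.
  by move: Qab; rewrite /Q/= y00 lt_max ltxx orbF => h; rewrite max_l// ltW.
apply: (@strictly_submean_no_max W e x0 y0 e0 y00).
  apply: mean_harmonic_atB; first exact: Vh.
  by apply: mean_harmonic_atZ; exact: barrier_mean_harmonic.
move=> x y y1; change (P x y <= P x0 y0); rewrite -QP.
have [Axy|nAxy] := pselect (A (x, y)).
  apply: le_trans (Qmax (x, y) _); last exact: mem_set.
  by rewrite /Q/= y1 le_max lexx.
have : V x y <= e.
  apply: hK => //; apply: contrapT => /not_orP[/negP + /negP].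
  rewrite -!leNgt => xK yK; apply: nAxy; split => /=; rewrite in_itv/=.
    by rewrite -ler_norml (le_trans xK).
  by rewrite (ltW y1) (le_trans yK).
by have := PV x y y1; lra.
Unshelve. all: by end_near. Qed.

End maximum_principle.

(** * Harmonic measure of an interval of the real line *)

Section interval_angle.
Context {R : realType}.

Lemma is_derive_atan_quot (x y c : R) : 0 < y ->
  is_derive c 1 (fun c => atan ((c - x) / y)) (y / ((c - x) ^+ 2 + y ^+ 2)).
Proof.
move=> y0.
have h : is_derive c 1 (fun c : R => (c - x) / y) y^-1.
  rewrite (_ : (fun _ => _) = y^-1 \*: ((@id R) - cst x)); last first.
    by apply/funext => z; rewrite /= mulrC.
  apply: is_derive_eq; by rewrite subr0 /GRing.scale/= mulr1.
apply: is_derive_eq.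
have ? : 0 < (c - x) ^+ 2 + y ^+ 2 by rewrite ltr_wpDl ?sqr_ge0// exprn_gt0.
have ? : 0 < y ^+ 2 + (c - x) ^+ 2 by rewrite addrC.
rewrite /GRing.scale/=; field.
by rewrite !gt_eqF.
Qed.

Let cross_angle (x y r c : R) : R := cross_diff (fun x y => atan ((c - x) / y)) x y r.

Let is_derive_cross_angle (x y r c : R) : 0 < r -> r < y / 2 ->
  exists2 d, is_derive c 1 (cross_angle x y r) d & `|d| <= 8 * r ^+ 4 / y ^+ 5.
Proof.
move=> r0 ry.
have y0 : 0 < y by lra.
have yr0 : 0 < y + r by lra.
have yr1 : 0 < y - r by lra.
exists (y / ((c - (x + r)) ^+ 2 + y ^+ 2) + y / ((c - (x - r)) ^+ 2 + y ^+ 2)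
  + (y + r) / ((c - x) ^+ 2 + (y + r) ^+ 2)
  + (y - r) / ((c - x) ^+ 2 + (y - r) ^+ 2)
  - 4 * (y / ((c - x) ^+ 2 + y ^+ 2))).
  have h1 := is_derive_atan_quot (x + r) c y0.
  have h2 := is_derive_atan_quot (x - r) c y0.
  have h3 := is_derive_atan_quot x c yr0.
  have h4 := is_derive_atan_quot x c yr1.
  have h5 := is_derive_atan_quot x c y0.
  rewrite (_ : cross_angle x y r =
    ((fun c => atan ((c - (x + r)) / y)) + (fun c => atan ((c - (x - r)) / y))
     + (fun c => atan ((c - x) / (y + r))) + (fun c => atan ((c - x) / (y - r)))
     - 4 \*: (fun c => atan ((c - x) / y)))) //.
  by apply: is_deriveB.
set s := c - x.
have -> : c - (x + r) = s - r by rewrite /s; ring.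
have -> : c - (x - r) = s + r by rewrite /s; ring.
pose n := s ^+ 2 + y ^+ 2.
pose P := ((s - r) ^+ 2 + y ^+ 2) * ((s + r) ^+ 2 + y ^+ 2) *
  (s ^+ 2 + (y + r) ^+ 2) * (s ^+ 2 + (y - r) ^+ 2).
pose N := 5 * s ^+ 4 * y - 10 * s ^+ 2 * y ^+ 3 + y ^+ 5 - r ^+ 4 * y.
have sq (a b : R) : 0 < b -> 0 < a ^+ 2 + b ^+ 2.
  by move=> b0; rewrite ltr_wpDl ?sqr_ge0// exprn_gt0.
have n0 : 0 < n by exact: sq.
have P0 : 0 < P by rewrite !mulr_gt0// sq.
have -> : y / ((s - r) ^+ 2 + y ^+ 2) + y / ((s + r) ^+ 2 + y ^+ 2)
  + (y + r) / (s ^+ 2 + (y + r) ^+ 2) + (y - r) / (s ^+ 2 + (y - r) ^+ 2)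
  - 4 * (y / (s ^+ 2 + y ^+ 2)) = 4 * r ^+ 4 * N / (n * P).
  by rewrite /N /n /P; field; rewrite !gt_eqF// sq.
have NnP : N ^+ 2 <= n * P.
  rewrite (_ : n * P = N ^+ 2 +
    (s ^+ 5 - 10 * s ^+ 3 * y ^+ 2 + 5 * s * y ^+ 4 - r ^+ 4 * s) ^+ 2).
    by rewrite lerDl sqr_ge0.
  by rewrite /N /n /P; ring.
have nP : (y ^+ 5 / 2) ^+ 2 <= n * P.
  have -> : (y ^+ 5 / 2) ^+ 2 = y ^+ 2 * (y ^+ 2 * y ^+ 2 * y ^+ 2 * (y / 2) ^+ 2).
    by ring.
  have sy (a b d : R) : 0 < d -> d <= b -> d ^+ 2 <= a ^+ 2 + b ^+ 2.
    move=> d0 db; apply: (@le_trans _ _ (b ^+ 2)); last by rewrite lerDr sqr_ge0.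
    by rewrite ler_sqr ?nnegrE//; lra.
  have e1 (a : R) : y ^+ 2 <= a ^+ 2 + y ^+ 2 by apply: sy.
  have e2 : y ^+ 2 <= s ^+ 2 + (y + r) ^+ 2 by apply: sy; lra.
  have e3 : (y / 2) ^+ 2 <= s ^+ 2 + (y - r) ^+ 2 by apply: sy; lra.
  have q0 := mulr_ge0 (sqr_ge0 y) (sqr_ge0 y).
  have q1 := mulr_ge0 q0 (sqr_ge0 y).
  have f1 := ler_pM (sqr_ge0 y) (sqr_ge0 y) (e1 (s - r)) (e1 (s + r)).
  have f2 := ler_pM q0 (sqr_ge0 y) f1 e2.
  have f3 := ler_pM q1 (sqr_ge0 (y / 2)) f2 e3.
  exact: ler_pM (sqr_ge0 y) (mulr_ge0 q1 (sqr_ge0 (y / 2))) (e1 s) f3.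
have y5 : 0 < y ^+ 5 by exact: exprn_gt0.
have r4 : 0 < r ^+ 4 by exact: exprn_gt0.
have nP0 : 0 < n * P by exact: mulr_gt0.
have NP : `|N| * (y ^+ 5 / 2) <= n * P.
  have NP0 : 0 <= `|N| * (y ^+ 5 / 2) by apply: mulr_ge0 => //; lra.
  rewrite -ler_sqr ?nnegrE//; last exact: ltW.
  rewrite exprMn real_normK ?num_real// [leRHS]expr2.
  by apply: ler_pM => //; exact: sqr_ge0.
have r40 : 0 < 4 * r ^+ 4 by exact: mulr_gt0.
rewrite normrM normfV (gtr0_norm nP0) [`|_ * N|]normrM (gtr0_norm r40).
rewrite ler_pdivrMr// [leRHS]mulrAC ler_pdivlMr//.
have -> : 4 * r ^+ 4 * `|N| * y ^+ 5 = 8 * r ^+ 4 * (`|N| * (y ^+ 5 / 2)).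
  by field.
by rewrite ler_pM2l// mulr_gt0.
Qed.

Lemma mean_harmonic_at_angle (a b x y : R) : a <= b -> 0 < y ->
  mean_harmonic_at (fun x y => atan ((b - x) / y) - atan ((a - x) / y)) x y.
Proof.
move=> ab y0 e e0; pose K := 8 * (b - a) / y ^+ 5.
have K0 : 0 <= K.
  by apply: divr_ge0; [lra|rewrite exprn_ge0// ltW].
near=> r.
have r0 : 0 < r by near: r; exact: nbhs_right_gt.
have r1 : r < 1 by near: r; exact: nbhs_right_lt.
have ry : r < y / 2 by near: r; apply: nbhs_right_lt; lra.
have rK : r < e / (K + 1) by near: r; apply: nbhs_right_lt; apply: divr_gt0 => //; lra.
have -> : cross_diff (fun x y => atan ((b - x) / y) - atan ((a - x) / y)) x y r
    = cross_angle x y r b - cross_angle x y r a.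
  by rewrite /cross_angle /cross_diff; ring.
have dF (c : R) := cid2 (is_derive_cross_angle x c r0 ry).
have Fd (c : R) : is_derive c 1 (cross_angle x y r) (s2val (dF c)) by exact: s2valP.
have Fc : {within `[a, b], continuous (cross_angle x y r)}.
  by apply: derivable_within_continuous => c _; exact: ex_derive.
have [c _ ->] := @MVT_segment R (cross_angle x y r) (fun c => s2val (dF c)) a b ab
  (fun c _ => Fd c) Fc.
have hd := s2valP' (dF c).
rewrite normrM [`|b - a|]ger0_norm; last lra.
apply: (@le_trans _ _ (8 * r ^+ 4 / y ^+ 5 * (b - a))).
  by apply: ler_wpM2r => //; lra.
rewrite (_ : _ * (b - a) = K * r ^+ 2 * r ^+ 2); last by rewrite /K; field; lra.
rewrite ler_pM2r ?exprn_gt0//.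
rewrite ltr_pdivlMr in rK; last lra.
have : r ^+ 2 <= r by rewrite expr2 ler_piMl// ltW.
nra.
Unshelve. all: by end_near. Qed.


Lemma angle_continuous (c x y : R) : 0 < y ->
  {for (x, y), continuous (fun z : R * R => atan ((c - z.1) / z.2))}.
Proof.
move=> y0; apply: (@continuous_comp _ _ _
  (fun z : R * R => (c - z.1) / z.2) (@atan R)); last exact: continuous_atan.
apply: cvgM; first by apply: cvgB; [exact: cvg_cst|exact: cvg_fst].
by apply: cvgV; [rewrite gt_eqF|exact: cvg_snd].
Qed.

Let atan_large (e : R) : 0 < e -> exists2 K : R, 0 < K &
  forall s, K < s -> pi / 2 - e <= atan s <= pi / 2.
Proof.
move=> e0; have /cvgrPdist_le/(_ e e0) [K [_ hK]] := @cvgy_atan R.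
exists (Num.max K 1); first by rewrite lt_max ltr01 orbT.
move=> s; rewrite gt_max => /andP[Ks _]; rewrite (ltW (atan_ltpi2 s)) andbT.
by have := hK s Ks; rewrite /= ler_norml; lra.
Qed.

Lemma angle_boundary (c p e : R) : c != p -> 0 < e ->
  exists2 d : R, 0 < d & forall x y : R, 0 < y -> `|x - p| < d -> y < d ->
    `|atan ((c - x) / y) - (-1) ^+ (c < p)%R * (pi / 2)| <= e.
Proof.
move=> cp e0; have [K K0 hK] := atan_large e0.
have g0 : 0 < `|c - p| by rewrite normr_gt0 subr_eq0.
exists (`|c - p| / (2 * (K + 1))); first by rewrite divr_gt0//; lra.
set d := _ / _ => x y y0 xp yd.
have d1 : d * (2 * (K + 1)) = `|c - p| by rewrite divfK// gt_eqF//; lra.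
have d0 : 0 < d by lra.
have Ky : K * y < K * d by rewrite ltr_pM2l.
have Kd : 0 < K * d by exact: mulr_gt0.
move: xp; rewrite ltr_norml => /andP[x1 x2].
have [cltp|pltc|ceqp] := ltgtP c p; last by rewrite ceqp eqxx in cp.
  have cn : `|c - p| = p - c by rewrite ltr0_norm; lra.
  have : K < - ((c - x) / y) by rewrite -mulNr ltr_pdivlMr//; lra.
  by move=> /hK; rewrite atanN expr1 mulN1r ler_norml; lra.
have cn : `|c - p| = c - p by rewrite gtr0_norm; lra.
have : K < (c - x) / y by rewrite ltr_pdivlMr//; lra.
by move=> /hK; rewrite expr0 mul1r ler_norml; lra.
Qed.

Lemma angle_infinity (a b e : R) : a <= b -> 0 < e ->
  exists K : R, forall x y : R, 0 < y -> K < `|x| \/ K < y ->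
    `|atan ((b - x) / y) - atan ((a - x) / y)| <= e.
Proof.
move=> ab e0; pose m := (b - a) / e; exists (`|a| + `|b| + m) => x y y0 hxy.
have me : m * e = b - a by rewrite divfK// gt_eqF.
have m0 : 0 <= m by apply: divr_ge0; lra.
have Fd (c : R) := is_derive_atan_quot x c y0.
have Fc : {within `[a, b], continuous (fun c => atan ((c - x) / y))}.
  by apply: derivable_within_continuous => c _; exact: ex_derive.
have [c] := MVT_segment ab (fun c _ => Fd c) Fc.
rewrite in_itv/= => /andP[ac cb] ->.
have n0 : 0 < (c - x) ^+ 2 + y ^+ 2 by rewrite ltr_wpDl ?sqr_ge0// exprn_gt0.
rewrite ger0_norm; last by apply: mulr_ge0; [apply: divr_ge0; exact: ltW|lra].
rewrite mulrAC ler_pdivrMr// -me.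
suff : m * y <= (c - x) ^+ 2 + y ^+ 2.
  by rewrite -(ler_pM2l e0); lra.
case: hxy => [hx|hy].
  have h : m <= `|c - x|.
    have : `|c| <= `|a| + `|b|.
      rewrite ler_norml; have := ler_norm b; have := ler_norm (- a).
      have := normr_ge0 a; have := normr_ge0 b; rewrite normrN; lra.
    have := ler_normD (x - c) c; rewrite subrK (distrC x c); lra.
  have <- : `|c - x| ^+ 2 = (c - x) ^+ 2 by rewrite real_normK ?num_real.
  move: h; set u := `|c - x| => h.
  have h1 : m * y <= u * y by rewrite ler_pM2r.
  have h2 := sqr_ge0 (u - y); have h3 := sqr_ge0 (u + y); lra.
have : m <= y by have := normr_ge0 a; have := normr_ge0 b; lra.
by rewrite -(ler_pM2r y0) -expr2; have := sqr_ge0 (c - x); lra.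
Qed.

End interval_angle.

Lemma half_plane_harmonic_measure {R : realType} (V : R -> R -> R) (a b : R)
    (X : seq R) : a <= b -> a \in X -> b \in X ->
  (forall x y : R, 0 < y ->
     {for (x, y), continuous (fun z : R * R => V z.1 z.2)}) ->
  (forall x y : R, 0 < y -> mean_harmonic_at V x y) ->
  (exists M, forall x y : R, 0 < y -> `|V x y| <= M) ->
  (forall p, p \notin X -> forall e : R, 0 < e ->
     exists2 d : R, 0 < d & forall x y : R, 0 < y -> `|x - p| < d -> y < d ->
       `|V x y - (a <= p <= b)%R%:R| <= e) ->
  (forall e : R, 0 < e ->
     exists K : R, forall x y : R, 0 < y -> K < `|x| \/ K < y ->
     `|V x y| <= e) ->
  forall x y : R, 0 < y ->
    V x y = (atan ((b - x) / y) - atan ((a - x) / y)) / pi.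
Proof.
move=> ab aX bX Vc Vh [M VM] Vbd Vinf.
have p0 : 0 < pi :> R by exact: pi_gt0.
pose h (x y : R) := pi^-1 * (atan ((b - x) / y) - atan ((a - x) / y)).
have main (s : R) : `|s| = 1 ->
    forall x y : R, 0 < y -> s * (V x y - h x y) <= 0.
  move=> s1.
  have sle (z : R) : s * z <= `|z|.
    by apply: (le_trans (ler_norm _)); rewrite normrM s1 mul1r.
  apply: (@half_plane_maximum_principle _ (fun x y => s * (V x y - h x y)) X).
  - move=> x y y0; apply: cvgM; first exact: cvg_cst.
    apply: cvgB; first exact: Vc.
    apply: cvgM; first exact: cvg_cst.
    by apply: cvgB; exact: angle_continuous.
  - move=> x y y0; apply: mean_harmonic_atZ; apply: mean_harmonic_atB.
      exact: Vh.
    by apply: mean_harmonic_atZ; exact: mean_harmonic_at_angle.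
  - exists (M + 1) => x y y0; apply: (le_trans (sle _)).
    apply: (le_trans (ler_normB _ _)); apply: lerD; first exact: VM.
    rewrite /h normrM normfV (gtr0_norm p0) ler_pdivrMl// mulr1.
    have := atan_gtNpi2 ((b - x) / y); have := atan_gtNpi2 ((a - x) / y).
    have := atan_ltpi2 ((b - x) / y); have := atan_ltpi2 ((a - x) / y).
    by rewrite ler_norml; lra.
  - move=> p pX e e0.
    have pa : a != p by apply: contraNneq pX => <-.
    have pb : b != p by apply: contraNneq pX => <-.
    have e20 : 0 < e / 2 by lra.
    have e40 : 0 < pi * e / 4 by rewrite divr_gt0// mulr_gt0.
    have [d1 d10 hd1] := Vbd p pX _ e20.
    have [d2 d20 hd2] := angle_boundary pa e40.
    have [d3 d30 hd3] := angle_boundary pb e40.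
    exists (Num.min d1 (Num.min d2 d3)); first by rewrite !lt_min d10 d20.
    move=> x y y0; rewrite !lt_min => /and3P[x1 x2 x3] /and3P[y1 y2 y3].
    have := hd1 x y y0 x1 y1; have := hd2 x y y0 x2 y2; have := hd3 x y y0 x3 y3.
    set B := atan _; set A := atan _ => hB hA hV.
    have hh : `|pi * (h x y - (a <= p <= b)%R%:R)| <= pi * e / 2.
      have -> : pi * (h x y - (a <= p <= b)%R%:R) =
          (B - (-1) ^+ (b < p)%R * (pi / 2)) - (A - (-1) ^+ (a < p)%R * (pi / 2)).
        rewrite mulrBr /h mulrA divff ?gt_eqF// mul1r -/A -/B.
        rewrite !le_eqVlt (negPf pa) (eq_sym p b) (negPf pb)/= (ltNge p b).
        rewrite le_eqVlt (negPf pb)/=.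
        case: (ltP a p) => hap; case: (ltP b p) => hbp; rewrite ?expr0 ?expr1 /=.
        + by field.
        + by field.
        + lra.
        + by field.
      by apply: (le_trans (ler_normB _ _)); lra.
    rewrite normrM (gtr0_norm p0) -mulrA ler_pM2l// in hh.
    apply: (le_trans (sle _)).
    rewrite (_ : V x y - h x y = (V x y - (a <= p <= b)%R%:R) -
      (h x y - (a <= p <= b)%R%:R)); last by ring.
    by apply: (le_trans (ler_normB _ _)); lra.
  - move=> e e0; have e20 : 0 < e / 2 by lra.
    have [K1 hK1] := Vinf _ e20.
    have pe0 : 0 < pi * (e / 2) by rewrite mulr_gt0.
    have [K2 hK2] := angle_infinity ab pe0.
    exists (Num.max K1 K2) => x y y0 hxy.
    have h1 : K1 < `|x| \/ K1 < y.
      by case: hxy; rewrite gt_max => /andP[? ?]; [left|right].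
    have h2 : K2 < `|x| \/ K2 < y.
      by case: hxy; rewrite gt_max => /andP[? ?]; [left|right].
    apply: (le_trans (sle _)); apply: (le_trans (ler_normB _ _)).
    have : `|h x y| <= e / 2.
      by rewrite /h normrM normfV (gtr0_norm p0) ler_pdivrMl// hK2.
    by have := hK1 x y y0 h1; lra.
move=> x y y0; rewrite mulrC -/(h x y).
have := main 1 (normr1 _) x y y0; have := main (-1) (normrN1 _) x y y0; lra.
Qed.

(** * Asymptotics of the singular solutions *)

Lemma cbrt_gt0 {R : realType} (t : R) : 0 < t -> 0 < cbrt t.
Proof. exact: powR_gt0. Qed.

Lemma exprn3_cbrt {R : realType} (t : R) : 0 <= t -> cbrt t ^+ 3 = t.
Proof.
by move=> t0; rewrite -powR_mulrn ?powR_ge0// -powRrM mulVf// powRr1.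
Qed.

Lemma cbrt_exprn3 {R : realType} (s : R) : 0 <= s -> cbrt (s ^+ 3) = s.
Proof. by move=> s0; rewrite /cbrt -powR_mulrn// -powRrM divff// powRr1. Qed.

Lemma is_derive_quadratic {R : realType} (a b x : R) :
  is_derive x 1 (fun x => a * x + b * x ^+ 2) (a + b * (2 * x)).
Proof.
have i2 : is_derive x 1 (fun s : R => s ^+ 2) (2 * x).
  apply: DeriveDef; first exact: exprn_derivable.
  by rewrite exp_derive /GRing.scale/= mulr1 expr1.
have := is_deriveD (@is_deriveZ _ _ _ (@id R) a x 1 1 (is_derive_id x 1))
  (@is_deriveZ _ _ _ (fun s : R => s ^+ 2) b x 1 _ i2).
by rewrite /GRing.scale/= mulr1.
Qed.

Lemma is_derive_add_quadratic {R : realType} (g : R -> R) (dg k a b s : R) :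
  is_derive s 1 g dg ->
  is_derive s 1 (fun s => k * g s + (a * s + b * s ^+ 2)) (k * dg + (a + b * (2 * s))).
Proof.
move=> h; have hg := @is_deriveZ _ _ _ g k s 1 dg h.
exact: (is_deriveD hg (is_derive_quadratic a b s)).
Qed.

Section comparison.
Context {R : realType}.

(* Look at the last time where [u <= 0]. *)
Lemma nonpos_of_derive_nonpos (u du : R -> R) (S : R) :
  u s @[s --> 0^'+] --> (0 : R) ->
  (forall s, 0 < s < S -> is_derive s 1 u (du s)) ->
  (forall s, 0 < s < S -> 0 < u s -> du s <= 0) ->
  forall s, 0 < s < S -> u s <= 0.
Proof.
move=> u0 ud du0 s0 /andP[s00 s0S]; rewrite leNgt; apply/negP => us0.
have uc (s : R) : 0 < s < S -> {for s, continuous u}.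
  move=> /ud h; apply: differentiable_continuous; apply/derivable1_diffP.
  exact: ex_derive.
have back (a : R) : 0 < a < s0 -> u a < u s0 -> exists2 c, a < c < s0 & u c <= 0.
  move=> /andP[a0 as0] uas0.
  have sub (x : R) : a <= x <= s0 -> 0 < x < S by move=> /andP[? ?]; lra.
  have [x|x|c] := @MVT R u du a s0 as0.
  - by rewrite in_itv/= => h; apply: ud; lra.
  - apply: continuous_in_subspaceT => z; rewrite inE/= in_itv/= => h.
    by apply: uc; apply: sub.
  rewrite in_itv/= => hc hu; exists c => //.
  rewrite leNgt; apply/negP => /(du0 c) h.
  have : du c <= 0 by apply: h; lra.
  have : 0 < s0 - a by lra.
  nra.
pose E : set R := [set x | 0 < x <= s0 /\ u x <= 0].
have [a as0 ua] : exists2 a : R, 0 < a < s0 & u a < u s0.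
  have /cvgrPdist_lt/(_ _ us0) h := u0.
  near (0 : R)^'+ => a; exists a.
    apply/andP; split; near: a; [exact: nbhs_right_gt|exact: nbhs_right_lt].
  have : `|0 - u a| < u s0 by near: a.
  by rewrite sub0r normrN => /(le_lt_trans (ler_norm _)).
have [b bs0 ub] := back a as0 ua.
have Eb : E b by split => //; lra.
have supE : has_sup E.
  by split; [exists b|exists s0 => x [/andP[]]].
set c := sup E.
have bc : b <= c by exact: sup_upper_bound.
have cs0 : c <= s0 by apply: sup_le_ub; [exists b|move=> x [/andP[]]].
have uc0 : u c <= 0.
  rewrite leNgt; apply/negP => uc0.
  have cS : 0 < c < S by lra.
  have /cvgrPdist_lt/(_ _ uc0) [d /= d0 hd] := uc c cS.
  have [x [x0 ux] cx] := sup_adherent d0 supE.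
  have xc : x <= c by apply: sup_upper_bound.
  have := hd x; rewrite /ball/= ger0_norm ?subr_ge0// => /(_ _).
  have : c - x < d by rewrite -/c in cx; lra.
  by move=> h /(_ h); rewrite ltr_norml; lra.
have ccs0 : 0 < c < s0.
  have : c != s0 by apply: contraTneq uc0 => ->; rewrite -ltNge.
  by rewrite neq_lt; lra.
have [e es0 ue] := back c ccs0 (le_lt_trans uc0 us0).
have : e <= c by apply: sup_upper_bound => //; split => //; lra.
lra.
Unshelve. all: by end_near. Qed.

End comparison.

Section singular.
Context {R : realType}.

Lemma singular_solution_derive (T : R) (y : R -> R) (s : R) :
  singular_solution cbrt T y -> 0 < s -> s ^+ 3 < T ->
  is_derive s 1 (fun s => y (s ^+ 3)) (6 * s ^+ 2 / (y (s ^+ 3) - s)).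
Proof.
move=> [_ yd] s0 sT.
have s3 : 0 < s ^+ 3 < T by rewrite exprn_gt0.
have [yn dy] := yd _ s3; rewrite cbrt_exprn3 ?ltW// in dy yn.
have d3 : is_derive s 1 (fun s : R => s ^+ 3) (3 * s ^+ 2).
  by apply: DeriveDef; [exact: exprn_derivable|rewrite exp_derive /GRing.scale/= mulr1].
have -> : 6 * s ^+ 2 / (y (s ^+ 3) - s) = 2 / (y (s ^+ 3) - s) * (3 * s ^+ 2).
  by field; rewrite subr_eq0.
exact: (@is_derive1_comp R y (fun s : R => s ^+ 3)).
Qed.

Lemma singular_solution_cvg (T : R) (y : R -> R) :
  singular_solution cbrt T y -> y (s ^+ 3) @[s --> 0^'+] --> (0 : R).
Proof.
move=> [y0 _]; apply/cvgrPdist_lt => e e0.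
have /cvgrPdist_lt/(_ _ e0) [d /= d0 hd] := y0.
near=> s.
have s0 : 0 < s by near: s; exact: nbhs_right_gt.
have s1 : s < 1 by near: s; exact: nbhs_right_lt.
have sd : s < d by near: s; exact: nbhs_right_lt.
have s3 : s ^+ 3 <= s by rewrite exprS ler_piMr ?ltW// exprn_ilt1// ltW.
apply: hd; last exact: exprn_gt0.
rewrite /ball/= sub0r normrN gtr0_norm ?exprn_gt0//; lra.
Unshelve. all: by end_near. Qed.


Section envelopes.
Variables (T S : R) (y : R -> R).
Hypotheses (ysol : singular_solution cbrt T y) (ST : S ^+ 3 <= T).

Let cube_lt (s : R) : 0 < s < S -> s ^+ 3 < T.
Proof.
by move=> /andP[s0 sS]; rewrite (lt_le_trans _ ST)// ltrXn2r// ltW// (lt_trans s0).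
Qed.

Let is_derive_sub_poly (k a b : R) (s : R) : 0 < s < S ->
  is_derive s 1 (fun s => k * y (s ^+ 3) + (a * s + b * s ^+ 2))
    (k * (6 * s ^+ 2 / (y (s ^+ 3) - s)) + (a + b * (2 * s))).
Proof.
move=> sS; have /andP[s0 _] := sS.
have h := singular_solution_derive ysol s0 (cube_lt sS).
exact: (is_derive_add_quadratic k a b h).
Qed.

Let cvg_sub_poly (k a b : R) :
  (k * y (s ^+ 3) + (a * s + b * s ^+ 2)) @[s --> 0^'+] --> (0 : R).
Proof.
rewrite [X in _ --> X](_ : _ = k * 0 + (a * 0 + b * 0 ^+ 2)); last first.
  by rewrite expr0n/=; ring.
have id0 : (s : R) @[s --> 0^'+] --> (0 : R) by exact: cvg_at_right_filter cvg_id.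
apply: cvgD; first by apply: cvgM; [exact: cvg_cst|exact: singular_solution_cvg ysol].
apply: cvgD; first by apply: cvgM; [exact: cvg_cst|].
by rewrite !expr2; apply: cvgM; [exact: cvg_cst|exact: cvgM].
Qed.

Lemma upper_solution_le (s : R) : (forall t, 0 < t < T -> cbrt t < y t) ->
  0 < s < S -> y (s ^+ 3) - s <= 6 * s ^+ 2.
Proof.
move=> ylt sS.
have := @nonpos_of_derive_nonpos R _ _ S (cvg_sub_poly 1 (-1) (-6))
  (is_derive_sub_poly 1 (-1) (-6)).
move=> /(_ _ s sS); rewrite !mul1r => h.
suff : y (s ^+ 3) + (-1 * s + -6 * s ^+ 2) <= 0 by lra.
apply: h => {sS}s sS; have /andP[s0 _] := sS.
have yv : 0 < y (s ^+ 3) - s.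
  by have := ylt (s ^+ 3); rewrite exprn_gt0// cube_lt// cbrt_exprn3 ?ltW//; lra.
move=> h; rewrite !mul1r.
have : 6 * s ^+ 2 / (y (s ^+ 3) - s) <= 1 by rewrite ler_pdivrMr//; lra.
lra.
Qed.

Lemma upper_solution_ge (s k : R) : (forall t, 0 < t < T -> cbrt t < y t) ->
  0 < k < 6 -> S <= k / 72 -> 0 < s < S -> (6 - k) * s ^+ 2 <= y (s ^+ 3) - s.
Proof.
move=> ylt /andP[k0 k6] Sk sS.
have := @nonpos_of_derive_nonpos R _ _ S (cvg_sub_poly (-1) 1 (6 - k))
  (is_derive_sub_poly (-1) 1 (6 - k)).
move=> /(_ _ s sS) h.
suff : -1 * y (s ^+ 3) + (1 * s + (6 - k) * s ^+ 2) <= 0 by lra.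
apply: h => {sS}s sS; have /andP[s0 s1] := sS.
have yv : 0 < y (s ^+ 3) - s.
  by have := ylt (s ^+ 3); rewrite exprn_gt0// cube_lt// cbrt_exprn3 ?ltW//; lra.
move=> h.
suff : 1 + k / 6 <= 6 * s ^+ 2 / (y (s ^+ 3) - s) by nra.
rewrite ler_pdivlMr//.
have : (1 + k / 6) * (y (s ^+ 3) - s) <= (1 + k / 6) * ((6 - k) * s ^+ 2).
  by rewrite ler_pM2l; lra.
have : 0 < s ^+ 2 by exact: exprn_gt0.
nra.
Qed.

Lemma lower_solution_le0 (s : R) : (forall t, 0 < t < T -> y t < cbrt t) ->
  0 < s < S -> y (s ^+ 3) <= 0.
Proof.
move=> ylt sS.
have := @nonpos_of_derive_nonpos R _ _ S (cvg_sub_poly 1 0 0)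
  (is_derive_sub_poly 1 0 0).
move=> /(_ _ s sS); rewrite !mul1r !mul0r !addr0; apply.
move=> {sS}s sS _; have /andP[s0 _] := sS.
have yv : y (s ^+ 3) - s < 0.
  by have := ylt (s ^+ 3); rewrite exprn_gt0// cube_lt// cbrt_exprn3 ?ltW//; lra.
rewrite !mul1r !mul0r !addr0 mulr_ge0_le0 ?invr_le0 ?(ltW yv)//.
by rewrite mulr_ge0// sqr_ge0.
Qed.

Lemma lower_solution_ge (s : R) : (forall t, 0 < t < T -> y t < cbrt t) ->
  0 < s < S -> - 3 * s ^+ 2 <= y (s ^+ 3).
Proof.
move=> ylt sS.
have := @nonpos_of_derive_nonpos R _ _ S (cvg_sub_poly (-1) 0 (-3))
  (is_derive_sub_poly (-1) 0 (-3)).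
move=> /(_ _ s sS) h.
suff : -1 * y (s ^+ 3) + (0 * s + -3 * s ^+ 2) <= 0 by lra.
apply: h => {sS}s sS _; have /andP[s0 _] := sS.
have y0 := lower_solution_le0 ylt sS.
have yv : 0 < s - y (s ^+ 3) by lra.
have : 6 * s ^+ 2 / (s - y (s ^+ 3)) <= 6 * s.
  by rewrite ler_pdivrMr//; nra.
rewrite -(opprB s) invrN mulrN; lra.
Qed.

End envelopes.

End singular.

Lemma atan_sub_bounds {R : realType} (p q s : R) : q <= p -> `|p| <= s -> `|q| <= s ->
  (p - q) * (1 - s ^+ 2) <= atan p - atan q <= p - q.
Proof.
move=> qp; rewrite !ler_norml => /andP[p1 p2] /andP[q1 q2].
have ac : {within `[q, p], continuous (@atan R)}.
  by apply: derivable_within_continuous => c _; exact: ex_derive.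
have [c] := MVT_segment qp (fun c _ => is_derive1_atan c) ac.
rewrite in_itv/= => /andP[qc cp] ->.
have c2 : c ^+ 2 <= s ^+ 2.
  by rewrite -[leLHS]real_normK ?num_real// ler_sqr ?nnegrE// ?ler_norml; lra.
have c20 := sqr_ge0 c; have c1 : 0 < 1 + c ^+ 2 by lra.
rewrite (mulrC (p - q)); apply/andP; split.
  apply: ler_wpM2r; first lra.
  rewrite -[leRHS]mul1r ler_pdivlMr//; nra.
rewrite -[leRHS]mul1r; apply: ler_wpM2r; first lra.
rewrite -[leLHS]mul1r ler_pdivrMr//; lra.
Qed.

Section ratio.
Context {R : realType}.
Variables (T : R) (f1 f2 : R -> R).
Hypotheses (T_gt0 : 0 < T).
Hypotheses (f1_singular : singular_solution cbrt T f1)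
  (f2_singular : singular_solution cbrt T f2).
Hypothesis f2_lt_f1 : forall t, 0 < t < T -> f2 t < cbrt t < f1 t.

Let f1_gt (t : R) : 0 < t < T -> cbrt t < f1 t.
Proof. by move=> /f2_lt_f1/andP[]. Qed.

Let f2_lt (t : R) : 0 < t < T -> f2 t < cbrt t.
Proof. by move=> /f2_lt_f1/andP[]. Qed.

Let cbrt_near (d : R) : 0 < d -> \forall t \near (0 : R)^'+, 0 < cbrt t < d.
Proof.
move=> d0; near=> t; rewrite cbrt_gt0/=; last by near: t; exact: nbhs_right_gt.
suff : `|0 - cbrt t| < d by rewrite sub0r normrN; exact: le_lt_trans (ler_norm _).
near: t; move: d d0; apply/cvgrPdist_lt; exact: powR_cvg0.
Unshelve. all: by end_near. Qed.

Let cube_min (d : R) : 0 < d -> Num.min d (cbrt T) ^+ 3 <= T.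
Proof.
move=> d0; apply: (@le_trans _ _ (cbrt T ^+ 3)); last by rewrite (exprn3_cbrt (ltW T_gt0)).
have c0 := ltW (cbrt_gt0 T_gt0).
by apply: lerXn2r; rewrite ?nnegrE// ?le_min ?(ltW d0)// ge_min lexx orbT.
Qed.

Let small_bounds (k t : R) : 0 < k <= 1 -> 0 < t ->
  cbrt t < Num.min (k / 72) (cbrt T) ->
  [/\ (6 - k) * cbrt t ^+ 2 <= f1 t - cbrt t <= 6 * cbrt t ^+ 2,
      -3 * cbrt t ^+ 2 <= f2 t <= 0 & 0 < cbrt t < k / 72].
Proof.
move=> /andP[k0 k1] t0 tS; set S := Num.min _ _ in tS.
have k720 : 0 < k / 72 by lra.
have ST : S ^+ 3 <= T by exact: cube_min.
have Sk : S <= k / 72 by rewrite ge_min lexx.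
have s0 : 0 < cbrt t < S by rewrite cbrt_gt0.
have k6 : 0 < k < 6 by lra.
have := upper_solution_ge f1_singular ST f1_gt k6 Sk s0.
have := upper_solution_le f1_singular ST f1_gt s0.
have := lower_solution_le0 f2_singular ST f2_lt s0.
have := lower_solution_ge f2_singular ST f2_lt s0.
rewrite exprn3_cbrt ?(ltW t0)// => -> -> -> ->; split => //.
by case/andP: s0 => -> /= /lt_le_trans; apply.
Qed.

Let angle1_cvg :
  (atan (f1 t) - atan (cbrt t)) / cbrt t ^+ 2 @[t --> 0^'+] --> (6 : R).
Proof.
apply/cvgrPdist_le => e e0; pose k := Num.min 1 (e / 2).
have k01 : 0 < k <= 1 by rewrite lt_min ltr01 ge_min lexx/= andbT; lra.
have ke : k <= e / 2 by rewrite ge_min lexx orbT.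
have d0 : 0 < Num.min (k / 72) (cbrt T).
  by rewrite lt_min cbrt_gt0// andbT; lra.
have e1 : 0 < e / 588 by lra.
near=> t.
have t0 : 0 < t by near: t; exact: nbhs_right_gt.
have /andP[_ td] : 0 < cbrt t < Num.min (k / 72) (cbrt T) by near: t; exact: cbrt_near.
have /andP[_ te] : 0 < cbrt t < e / 588 by near: t; exact: cbrt_near.
have [/andP[h1 h2] _ /andP[s0 s1]] := small_bounds k01 t0 td.
set s := cbrt t in td te h1 h2 s0 s1 *.
have s20 : 0 < s ^+ 2 by exact: exprn_gt0.
have ss : s ^+ 2 <= s by rewrite expr2 ler_piMr; lra.
have k60 : 0 <= (6 - k) * s ^+ 2 by rewrite mulr_ge0; lra.
have sf : s <= f1 t by lra.
have f7 : `|f1 t| <= 7 * s by rewrite ler_norml; lra.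
have s7 : `|s| <= 7 * s by rewrite ler_norml; lra.
have /andP[a1 a2] := atan_sub_bounds sf f7 s7.
have q1 : (atan (f1 t) - atan s) / s ^+ 2 <= 6 by rewrite ler_pdivrMr//; lra.
have q2 : (6 - e) <= (atan (f1 t) - atan s) / s ^+ 2.
  rewrite ler_pdivlMr//; apply: le_trans a1.
  have k0 : 0 < k by lra.
  have h49 : 0 <= 1 - (7 * s) ^+ 2.
    have : (7 * s) ^+ 2 = 49 * s ^+ 2 by ring.
    lra.
  apply: (@le_trans _ _ ((6 - k) * s ^+ 2 * (1 - (7 * s) ^+ 2))); last first.
    exact: ler_wpM2r.
  rewrite mulrAC ler_pM2r//; nra.
by rewrite ler_norml; lra.
Unshelve. all: by end_near. Qed.

Let angle2_cvg :
  (atan (cbrt t) - atan (f2 t)) / cbrt t @[t --> 0^'+] --> (1 : R).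
Proof.
apply/cvgrPdist_le => e e0.
have k01 : 0 < (1 : R) <= 1 by rewrite ltr01 lexx.
have d0 : 0 < Num.min (1 / 72) (cbrt T).
  by rewrite lt_min cbrt_gt0// andbT; lra.
have e1 : 0 < e / 49 by lra.
near=> t.
have t0 : 0 < t by near: t; exact: nbhs_right_gt.
have /andP[_ td] : 0 < cbrt t < Num.min (1 / 72) (cbrt T) by near: t; exact: cbrt_near.
have /andP[_ te] : 0 < cbrt t < e / 49 by near: t; exact: cbrt_near.
have [_ /andP[h1 h2] /andP[s0 s1]] := small_bounds k01 t0 td.
set s := cbrt t in td te h1 h2 s0 s1 *.
have s20 : 0 < s ^+ 2 by exact: exprn_gt0.
have ss : s ^+ 2 <= s by rewrite expr2 ler_piMr; lra.
have sf : f2 t <= s by lra.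
have f7 : `|f2 t| <= 7 * s by rewrite ler_norml; lra.
have s7 : `|s| <= 7 * s by rewrite ler_norml; lra.
have /andP[a1 a2] := atan_sub_bounds sf s7 f7.
have se : s ^+ 2 <= e / 49 * s by rewrite expr2 ler_pM2r// ltW.
have q1 : (atan s - atan (f2 t)) / s <= 1 + e.
  rewrite ler_pdivrMr// mulrDl mul1r; have es : 0 < e * s by exact: mulr_gt0.
  lra.
have q2 : (1 - e) <= (atan s - atan (f2 t)) / s.
  rewrite ler_pdivlMr//; apply: le_trans a1.
  have h49 : 0 <= 1 - (7 * s) ^+ 2.
    have : (7 * s) ^+ 2 = 49 * s ^+ 2 by ring.
    lra.
  apply: (@le_trans _ _ (s * (1 - (7 * s) ^+ 2))); last by apply: ler_wpM2r; lra.
  rewrite mulrC ler_pM2l//; nra.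
by rewrite ler_norml; lra.
Unshelve. all: by end_near. Qed.

Lemma angle_ratio_cvg (m1 m2 : R -> R) :
  (forall t, 0 < t < T -> m1 t = (atan (f1 t) - atan (cbrt t)) / pi) ->
  (forall t, 0 < t < T -> m2 t = (atan (cbrt t) - atan (f2 t)) / pi) ->
  m1 t / (m2 t) ^+ 2 @[t --> 0^'+] --> (6 * pi : R).
Proof.
move=> m1E m2E.
have c2 : ((atan (cbrt t) - atan (f2 t)) / cbrt t) ^+ 2 @[t --> 0^'+] --> (1 : R).
  rewrite -[X in _ --> X](mulr1 1).
  by under eq_fun do rewrite expr2; apply: cvgM; exact: angle2_cvg.
have FF : Filter ((0 : R)^'+) by exact: _.
have c3 := cvgM angle1_cvg (cvgM (cvgV (oner_neq0 _) c2) (cvg_cst pi)).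
have E : \forall t \near (0 : R)^'+, m1 t / (m2 t) ^+ 2 =
    ((atan (f1 t) - atan (cbrt t)) / cbrt t ^+ 2) *
    ((((atan (cbrt t) - atan (f2 t)) / cbrt t) ^+ 2)^-1 * pi).
  near=> t.
  have t0 : 0 < t by near: t; exact: nbhs_right_gt.
  have tT : t < T by near: t; exact: nbhs_right_lt.
  have t0T : 0 < t < T by rewrite t0.
  have s0 := cbrt_gt0 t0.
  rewrite m1E// m2E//; move: (pi) (pi_gt0 R) => p p0; field.
  have h : 0 < atan (cbrt t) - atan (f2 t) by rewrite subr_gt0 lt_atan ?f2_lt.
  by rewrite (gt_eqF s0) (gt_eqF h) (gt_eqF p0).
rewrite invr1 mul1r in c3; have {}c3 := c3 FF FF FF FF.
apply: cvg_trans c3; apply: near_eq_cvg; apply: filterS E => t Et.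
by rewrite /= Et.
Unshelve. all: by end_near. Qed.

End ratio.

(** * Taylor's formula for harmonic functions *)

Section complex_plane.
Context {R : realType}.
Implicit Types (z : Cplx R) (x y : R).

Lemma normr_complexE z : `|z| = (Normc.normc z)%:C.
Proof. by case: z. Qed.

Lemma normc_le_abs z : Normc.normc z <= `|complex.Re z| + `|complex.Im z|.
Proof.
case: z => a b /=; have ab0 : 0 <= `|a| + `|b| by exact: addr_ge0.
rewrite -(ger0_norm ab0) -(sqrtr_sqr (`|a| + `|b|)) ler_sqrt ?sqr_ge0//.
rewrite sqrrD !real_normK ?num_real//.
by rewrite -addrA lerD2l lerDr mulrn_wge0// mulr_ge0.
Qed.

Lemma abs_Re_le_normc z : `|complex.Re z| <= Normc.normc z.
Proof.
case: z => a b /=.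
by rewrite -sqrtr_sqr ler_sqrt ?addr_ge0 ?sqr_ge0// lerDl sqr_ge0.
Qed.

Lemma abs_Im_le_normc z : `|complex.Im z| <= Normc.normc z.
Proof.
case: z => a b /=.
by rewrite -sqrtr_sqr ler_sqrt ?addr_ge0 ?sqr_ge0// lerDr sqr_ge0.
Qed.

Lemma nbhs_Cplx_box z (P : set (Cplx R)) : nbhs z P <->
  exists2 d : R, 0 < d & forall x y, `|x - complex.Re z| < d ->
    `|y - complex.Im z| < d -> P (x +i* y).
Proof.
rewrite nbhs_ballP; split => [[[e e']]|[d d0 hd]].
  rewrite /= ltcE/= => /andP[/eqP -> e0] he; exists (e / 2); first by lra.
  move=> x y hx hy; apply: he; rewrite /ball/= normr_complexE ltcR.
  apply: le_lt_trans (normc_le_abs _) _; case: z hx hy => a b /= hx hy.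
  rewrite (distrC a) (distrC b); lra.
exists (d%:C); first by rewrite /= ltcR.
move=> [x y]; rewrite /ball/= normr_complexE ltcR => h; apply: hd; rewrite distrC.
  by apply: le_lt_trans h; case: z => a b; exact: abs_Re_le_normc ((a - x) +i* (b - y)).
by apply: le_lt_trans h; case: z => a b; exact: abs_Im_le_normc ((a - x) +i* (b - y)).
Qed.

Lemma continuous_Cplx_box (u : Cplx R -> R) z : {for z, continuous u} <->
  forall e : R, 0 < e -> exists2 d : R, 0 < d & forall x y,
    `|x - complex.Re z| < d -> `|y - complex.Im z| < d -> `|u (x +i* y) - u z| < e.
Proof.
have F := nbhs_filter z.
have E := @cvgrPdist_lt _ R _ (nbhs z) F u (u z).
split=> [/E uz e e0|uz].
  have /nbhs_Cplx_box[d d0 hd] := uz e e0; exists d => // x y hx hy.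
  by rewrite distrC; exact: hd.
apply/E => e e0; apply/nbhs_Cplx_box.
by have [d d0 hd] := uz e e0; exists d => // x y hx hy; rewrite distrC; exact: hd.
Qed.

End complex_plane.

Section taylor.
Context {R : realType}.

Lemma derive_bound_dist (f df : R -> R) (a b M : R) :
  (forall x, `|x - a| <= `|b - a| -> is_derive x 1 f (df x)) ->
  (forall x, `|x - a| <= `|b - a| -> `|df x| <= M) ->
  `|f b - f a| <= M * `|b - a|.
Proof.
move=> fd dfM.
have fc (c d : R) : (forall x, c <= x <= d -> `|x - a| <= `|b - a|) ->
    {within `[c, d], continuous f}.
  move=> h; apply: derivable_within_continuous => x; rewrite in_itv/= => /h/fd.
  by move=> ?; exact: ex_derive.
have [ab|/ltW ba] := leP a b.
  have h (x : R) : a <= x <= b -> `|x - a| <= `|b - a|.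
    by move=> ?; rewrite !ger0_norm; lra.
  have [x|c] := @MVT_segment R f df a b ab _ (fc _ _ h).
    by rewrite in_itv/= => /andP[? ?]; apply: fd; apply: h; lra.
  by rewrite in_itv/= => /h/dfM hc ->; rewrite normrM ler_wpM2r.
have h (x : R) : b <= x <= a -> `|x - a| <= `|b - a|.
  by move=> ?; rewrite !ler0_norm; lra.
have [x|c] := @MVT_segment R f df b a ba _ (fc _ _ h).
  by rewrite in_itv/= => /andP[? ?]; apply: fd; apply: h; lra.
rewrite in_itv/= => /h/dfM hc e; rewrite distrC e normrM (distrC a b).
by rewrite ler_wpM2r.
Qed.

Lemma C1_first_order (G G1 G2 : R -> R -> R) (x0 y0 r : R) : 0 < r ->
  (forall x y, `|x - x0| < r -> `|y - y0| < r ->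
     is_derive x 1 (G^~ y) (G1 x y) /\ is_derive y 1 (G x) (G2 x y)) ->
  (forall e, 0 < e -> exists2 d : R, 0 < d & forall x y,
     `|x - x0| < d -> `|y - y0| < d ->
     `|G1 x y - G1 x0 y0| < e /\ `|G2 x y - G2 x0 y0| < e) ->
  forall e, 0 < e -> exists2 d : R, 0 < d & forall h k, `|h| < d -> `|k| < d ->
    `|G (x0 + h) (y0 + k) - G x0 y0 - (h * G1 x0 y0 + k * G2 x0 y0)|
      <= e * (`|h| + `|k|).
Proof.
move=> r0 Gd Gc e e0; have [d d0 hd] := Gc e e0.
exists (Num.min d r); first by rewrite lt_min d0.
move=> h k; rewrite !lt_min => /andP[hh hr] /andP[kk kr].
have i1 (x : R) : is_derive x 1 (fun x => x * G1 x0 y0) (G1 x0 y0).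
  have := @is_deriveM _ _ id (cst (G1 x0 y0)) x 1 _ _ (is_derive_id _ _) (is_derive_cst _ _ _).
  by rewrite scaler0 add0r /GRing.scale/= mulr1.
have i2 (x : R) : is_derive x 1 (fun x => x * G2 x0 y0) (G2 x0 y0).
  have := @is_deriveM _ _ id (cst (G2 x0 y0)) x 1 _ _ (is_derive_id _ _) (is_derive_cst _ _ _).
  by rewrite scaler0 add0r /GRing.scale/= mulr1.
have A : `|(G (x0 + h) (y0 + k) - (x0 + h) * G1 x0 y0) -
    (G x0 (y0 + k) - x0 * G1 x0 y0)| <= e * `|h|.
  have := @derive_bound_dist (fun x => G x (y0 + k) - x * G1 x0 y0)
    (fun x => G1 x (y0 + k) - G1 x0 y0) x0 (x0 + h) e.
  rewrite (addrC x0 h) addrK; apply => x xh.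
    have [dG _] := Gd x (y0 + k) (le_lt_trans xh hr) ltac:(by rewrite addrAC subrr add0r).
    exact: is_deriveB.
  apply: ltW; have [] // := hd x (y0 + k) (le_lt_trans xh hh).
  by rewrite addrAC subrr add0r.
have B : `|(G x0 (y0 + k) - (y0 + k) * G2 x0 y0) -
    (G x0 y0 - y0 * G2 x0 y0)| <= e * `|k|.
  have := @derive_bound_dist (fun y => G x0 y - y * G2 x0 y0)
    (fun y => G2 x0 y - G2 x0 y0) y0 (y0 + k) e.
  have x00 (q : R) : 0 < q -> `|x0 - x0| < q by rewrite subrr normr0.
  rewrite (addrC y0 k) addrK; apply => y yk.
    have [_ dG] := Gd x0 y (x00 _ r0) (le_lt_trans yk kr).
    exact: is_deriveB.
  by apply: ltW; have [] := hd x0 y (x00 _ d0) (le_lt_trans yk kk).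
rewrite mulrDr; apply: le_trans (lerD A B); apply: le_trans (ler_normD _ _).
rewrite le_eqVlt; apply/predU1P; left; congr (`|_|); ring.
Qed.

End taylor.

Section harmonic_taylor.
Context {R : realType}.

Lemma is_derive_translate (f : R -> R) (a s d : R) :
  is_derive (a + s) 1 f d -> is_derive s 1 (fun s => f (a + s)) d.
Proof.
move=> h.
have i : is_derive s 1 (fun s => a + s) 1.
  by have := is_deriveD (is_derive_cst a s 1) (is_derive_id s 1); rewrite add0r.
by have := is_derive1_comp h i; rewrite mulr1.
Qed.

Lemma C1_on_box (D : set (Cplx R)) (u : Cplx R -> R) (x0 y0 : R) :
  C1_on D u -> nbhs (x0 +i* y0 : Cplx R) D ->
  forall e, 0 < e -> exists2 d : R, 0 < d & forall h k, `|h| < d -> `|k| < d ->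
    `|u ((x0 + h) +i* (y0 + k)) - u (x0 +i* y0)
       - (h * dRe u (x0 +i* y0) + k * dIm u (x0 +i* y0))| <= e * (`|h| + `|k|).
Proof.
move=> uD Dz.
have /nbhs_Cplx_box[r r0 hr] := Dz.
apply: (@C1_first_order R (fun x y => u (x +i* y)) (fun x y => dRe u (x +i* y))
  (fun x y => dIm u (x +i* y)) x0 y0 r r0).
  move=> x y hx hy; have [d1 d2 _ _] := uD _ (hr x y hx hy).
  by split; [exact: (derivableP d1)|exact: (derivableP d2)].
move=> e e0; have [_ _ c1 c2] := uD _ (nbhs_singleton Dz).
have [d1 d10 h1] := (continuous_Cplx_box _ _).1 c1 e e0.
have [d2 d20 h2] := (continuous_Cplx_box _ _).1 c2 e e0.
exists (Num.min d1 d2); first by rewrite lt_min d10.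
move=> x y; rewrite !lt_min => /andP[x1 x2] /andP[y1 y2].
by split; [exact: h1|exact: h2].
Qed.

(* Taylor's formula of order two; the Laplace equation is what turns the
   quadratic part into a combination of Re d^2 and Im d^2, for d = h + i k. *)
Lemma harmonic_taylor (D : set (Cplx R)) (u : Cplx R -> R) (x0 y0 : R) :
  harmonic_on D u -> nbhs (x0 +i* y0 : Cplx R) D ->
  exists l1 l2 q1 q2 : R, forall e, 0 < e ->
  exists2 d : R, 0 < d & forall h k, `|h| < d -> `|k| < d ->
    `|u ((x0 + h) +i* (y0 + k)) - u (x0 +i* y0)
       - (h * l1 + k * l2) - (q1 * (h ^+ 2 - k ^+ 2) + q2 * (2 * h * k))|
      <= e * (`|h| + `|k|) ^+ 2.
Proof.
move=> [u0 u1 u2 lap] Dz; set z0 : Cplx R := x0 +i* y0.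
have alg1 (a b c p q t : R) : a - b - (p * c + t * q) = a - (b + p * c + q / 2 * (2 * t)).
  by lra.
have alg2 (a b p q t : R) : a - b - (t * p + 0 * q) = a - (b + p / 2 * (2 * t)).
  by lra.
have alg3 (w w1 w0 p q r s c h k : R) : r + s = 0 ->
    w - w0 - (h * p + k * q) - (r / 2 * (h ^+ 2 - k ^+ 2) + c / 2 * (2 * h * k)) =
    w - ((q + h * c) * k + s / 2 * k ^+ 2) - (w1 - ((q + h * c) * 0 + s / 2 * 0 ^+ 2))
    + (w1 - (p * h + r / 2 * h ^+ 2) - (w0 - (p * 0 + r / 2 * 0 ^+ 2))).
  move=> rs; have -> : s = - r by lra.
  by lra.
have alg4 (e h k : R) : 0 < e ->
    e * (`|h| + `|k|) * `|k| + e * `|h| * `|h| <= e * (`|h| + `|k|) ^+ 2.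
  move=> e0; rewrite -!mulrA -mulrDr ler_pM2l// expr2.
  by have := mulr_ge0 (normr_ge0 h) (normr_ge0 k); lra.
have {}lap := lap _ (nbhs_singleton Dz); rewrite -/z0 in lap.
exists (dRe u z0), (dIm u z0), (dRe (dRe u) z0 / 2), (dRe (dIm u) z0 / 2).
move=> e e0.
have /nbhs_Cplx_box[r r0 hr] := Dz.
have [d1 d10 h1] := C1_on_box u1 Dz e0.
have [d2 d20 h2] := C1_on_box u2 Dz e0.
exists (Num.min r (Num.min d1 d2)); first by rewrite !lt_min r0 d10.
move=> h k; rewrite !lt_min => /and3P[hr0 hd1 hd2] /and3P[kr kd1 kd2].
have nn (s b : R) : `|b + s - b| = `|s| by rewrite addrAC subrr add0r.
pose a2 := dIm u z0 + h * dRe (dIm u) z0; pose b2 := dIm (dIm u) z0 / 2.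
have A : `|(u ((x0 + h) +i* (y0 + k)) - (a2 * k + b2 * k ^+ 2)) -
    (u ((x0 + h) +i* (y0 + 0)) - (a2 * 0 + b2 * 0 ^+ 2))|
    <= e * (`|h| + `|k|) * `|k - 0|.
  apply: (@derive_bound_dist R
    (fun s => u ((x0 + h) +i* (y0 + s)) - (a2 * s + b2 * s ^+ 2))
    (fun s => dIm u ((x0 + h) +i* (y0 + s)) - (a2 + b2 * (2 * s)))) => s.
    rewrite !subr0 => sk.
    have [|_ du _ _] := u0 ((x0 + h) +i* (y0 + s)).
      by apply: hr; rewrite /= nn// (le_lt_trans sk).
    have du' := @is_derive_translate (fun y => u ((x0 + h) +i* y)) y0 s _ (derivableP du).
    exact: (is_deriveB du' (is_derive_quadratic a2 b2 s)).
  rewrite !subr0 => sk; have := h2 h s hd2 (le_lt_trans sk kd2).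
  have -> : dIm u ((x0 + h) +i* (y0 + s)) - dIm u (x0 +i* y0)
       - (h * dRe (dIm u) (x0 +i* y0) + s * dIm (dIm u) (x0 +i* y0)) =
      dIm u ((x0 + h) +i* (y0 + s)) - (a2 + b2 * (2 * s)).
    exact: alg1.
  by move=> /le_trans; apply; rewrite ler_pM2l// lerD2l.
pose a1 := dRe u z0; pose b1 := dRe (dRe u) z0 / 2.
have B : `|(u ((x0 + h) +i* (y0 + 0)) - (a1 * h + b1 * h ^+ 2)) -
    (u ((x0 + 0) +i* (y0 + 0)) - (a1 * 0 + b1 * 0 ^+ 2))|
    <= e * `|h| * `|h - 0|.
  apply: (@derive_bound_dist R
    (fun s => u ((x0 + s) +i* (y0 + 0)) - (a1 * s + b1 * s ^+ 2))
    (fun s => dRe u ((x0 + s) +i* (y0 + 0)) - (a1 + b1 * (2 * s)))) => s.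
    rewrite !subr0 => sh.
    have [|du _ _ _] := u0 ((x0 + s) +i* (y0 + 0)).
      by apply: hr; rewrite /= nn ?normr0// (le_lt_trans sh).
    have du' := @is_derive_translate (fun x => u (x +i* (y0 + 0))) x0 s _ (derivableP du).
    exact: (is_deriveB du' (is_derive_quadratic a1 b1 s)).
  rewrite !subr0 => sh; have := h1 s 0 (le_lt_trans sh hd1).
  rewrite normr0 => /(_ d10); rewrite (addr0 `|s|).
  have -> : dRe u ((x0 + s) +i* (y0 + 0)) - dRe u (x0 +i* y0)
       - (s * dRe (dRe u) (x0 +i* y0) + 0 * dIm (dRe u) (x0 +i* y0)) =
      dRe u ((x0 + s) +i* (y0 + 0)) - (a1 + b1 * (2 * s)).
    exact: alg2.
  by move=> /le_trans; apply; rewrite ler_pM2l.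
rewrite !subr0 in A B.
apply: le_trans (alg4 e h k e0).
apply: le_trans (lerD A B); apply: le_trans (ler_normD _ _).
by rewrite !addr0 (alg3 _ (u ((x0 + h) +i* y0)) _ _ _ _ _ _ _ _ lap).
Qed.

End harmonic_taylor.

(** * Estimates for the Loewner flow *)

Section complex_gronwall.
Context {R : realType}.
Local Notation nc := (@Normc.normc R).
Implicit Types (y A : R -> Cplx R) (v w z : Cplx R).

Lemma normc_ge0 z : 0 <= nc z.
Proof. by case: z => a b; exact: sqrtr_ge0. Qed.

Lemma normc_sqr z : nc z ^+ 2 = complex.Re z ^+ 2 + complex.Im z ^+ 2.
Proof. by case: z => a b; rewrite /= sqr_sqrtr// addr_ge0// sqr_ge0. Qed.

Lemma normc_sum (I : Type) (s : seq I) (F : I -> Cplx R) :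
  nc (\sum_(i <- s) F i) <= \sum_(i <- s) nc (F i).
Proof.
elim: s => [|i s ih]; first by rewrite !big_nil Normc.normc0.
by rewrite !big_cons (le_trans (le_normcD _ _))// lerD2l.
Qed.

Definition cderiv y (s : R) v : Prop :=
  is_derive s 1 (fun r => complex.Re (y r)) (complex.Re v) /\
  is_derive s 1 (fun r => complex.Im (y r)) (complex.Im v).

Lemma Cplx_ReD z w : complex.Re (z + w) = complex.Re z + complex.Re w.
Proof. by case: z; case: w. Qed.

Lemma Cplx_ImD z w : complex.Im (z + w) = complex.Im z + complex.Im w.
Proof. by case: z; case: w. Qed.

Lemma Cplx_ReB z w : complex.Re (z - w) = complex.Re z - complex.Re w.
Proof. by case: z; case: w. Qed.

Lemma Cplx_ImB z w : complex.Im (z - w) = complex.Im z - complex.Im w.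
Proof. by case: z; case: w. Qed.

Lemma Cplx_ReM z w :
  complex.Re (z * w) = complex.Re z * complex.Re w - complex.Im z * complex.Im w.
Proof. by case: z; case: w. Qed.

Lemma Cplx_ImM z w :
  complex.Im (z * w) = complex.Re z * complex.Im w + complex.Im z * complex.Re w.
Proof. by case: z; case: w. Qed.

Lemma cderivB y1 y2 s v1 v2 : cderiv y1 s v1 -> cderiv y2 s v2 ->
  cderiv (fun r => y1 r - y2 r) s (v1 - v2).
Proof.
move=> [a1 b1] [a2 b2]; split; rewrite ?Cplx_ReB ?Cplx_ImB.
  rewrite (_ : (fun _ => _) = (fun r => complex.Re (y1 r)) - (fun r => complex.Re (y2 r))).
    exact: is_deriveB.
  by apply/funext => r; rewrite ?Cplx_ReB ?Cplx_ImB.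
rewrite (_ : (fun _ => _) = (fun r => complex.Im (y1 r)) - (fun r => complex.Im (y2 r))).
  exact: is_deriveB.
by apply/funext => r; rewrite ?Cplx_ReB ?Cplx_ImB.
Qed.

Lemma cderiv0 s : cderiv (fun=> 0) s 0.
Proof. by split; exact: is_derive_cst. Qed.

Lemma cderivD y1 y2 s v1 v2 : cderiv y1 s v1 -> cderiv y2 s v2 ->
  cderiv (fun r => y1 r + y2 r) s (v1 + v2).
Proof.
move=> h1 h2; have h0 := cderivB (cderiv0 s) h2.
have := cderivB h1 h0; rewrite sub0r opprK.
by under [X in cderiv X]eq_fun do rewrite sub0r opprK.
Qed.

Lemma cderiv_sum (I : Type) (l : seq I) (F : I -> R -> Cplx R) s (v : I -> Cplx R) :
  (forall i, cderiv (F i) s (v i)) ->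
  cderiv (fun r => \sum_(i <- l) F i r) s (\sum_(i <- l) v i).
Proof.
move=> h; elim: l => [|i l ih].
  by under eq_fun do rewrite big_nil; rewrite big_nil; exact: cderiv0.
under eq_fun do rewrite big_cons; rewrite big_cons; exact: cderivD.
Qed.

Lemma cderivM y1 y2 s v1 v2 : cderiv y1 s v1 -> cderiv y2 s v2 ->
  cderiv (fun r => y1 r * y2 r) s (y1 s * v2 + v1 * y2 s).
Proof.
move=> [a1 b1] [a2 b2]; split.
  rewrite (_ : (fun _ => _) =
    (fun r => complex.Re (y1 r)) * (fun r => complex.Re (y2 r)) -
    (fun r => complex.Im (y1 r)) * (fun r => complex.Im (y2 r))); last first.
    by apply/funext => r; rewrite Cplx_ReM.
  have h := is_deriveB (is_deriveM a1 a2) (is_deriveM b1 b2).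
  apply: is_derive_eq; rewrite Cplx_ReD !Cplx_ReM /GRing.scale/=; ring.
rewrite (_ : (fun _ => _) =
  (fun r => complex.Re (y1 r)) * (fun r => complex.Im (y2 r)) +
  (fun r => complex.Im (y1 r)) * (fun r => complex.Re (y2 r))); last first.
  by apply/funext => r; rewrite Cplx_ImM.
have h := is_deriveD (is_deriveM a1 b2) (is_deriveM b1 a2).
apply: is_derive_eq; rewrite Cplx_ImD !Cplx_ImM /GRing.scale/=; ring.
Qed.

Definition ccont y (t : R) : Prop :=
  {within `[0, t], continuous (fun r => complex.Re (y r))} /\
  {within `[0, t], continuous (fun r => complex.Im (y r))}.

Lemma continuous_ccont y t : {within `[0, t], continuous y} -> ccont y t.
Proof.
move=> yc; split=> x.
  apply: (@continuous_comp _ _ _ (y : subspace _ -> _) (fun z : Cplx R => complex.Re z)).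
    exact: yc.
  apply/continuous_Cplx_box => e e0; exists e => // a b h _; exact: h.
apply: (@continuous_comp _ _ _ (y : subspace _ -> _) (fun z : Cplx R => complex.Im z)).
  exact: yc.
apply/continuous_Cplx_box => e e0; exists e => // a b _ h; exact: h.
Qed.

Lemma ccontB y1 y2 t : ccont y1 t -> ccont y2 t -> ccont (fun r => y1 r - y2 r) t.
Proof.
move=> [a1 b1] [a2 b2]; split.
  rewrite (_ : (fun _ => _) = fun r => complex.Re (y1 r) - complex.Re (y2 r)).
    by move=> x; apply: cvgB; [exact: a1|exact: a2].
  by apply/funext => r; rewrite ?Cplx_ReB ?Cplx_ImB.
rewrite (_ : (fun _ => _) = fun r => complex.Im (y1 r) - complex.Im (y2 r)).
  by move=> x; apply: cvgB; [exact: b1|exact: b2].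
by apply/funext => r; rewrite ?Cplx_ReB ?Cplx_ImB.
Qed.

Lemma ccontM y1 y2 t : ccont y1 t -> ccont y2 t -> ccont (fun r => y1 r * y2 r) t.
Proof.
move=> [a1 b1] [a2 b2]; split.
  rewrite (_ : (fun _ => _) = fun r => complex.Re (y1 r) * complex.Re (y2 r)
      - complex.Im (y1 r) * complex.Im (y2 r)); last by apply/funext => r; rewrite Cplx_ReM.
  by move=> x; apply: cvgB; apply: cvgM;
    [exact: a1|exact: a2|exact: b1|exact: b2].
rewrite (_ : (fun _ => _) = fun r => complex.Re (y1 r) * complex.Im (y2 r)
    + complex.Im (y1 r) * complex.Re (y2 r)); last by apply/funext => r; rewrite Cplx_ImM.
by move=> x; apply: cvgD; apply: cvgM;
  [exact: a1|exact: b2|exact: b1|exact: a2].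
Qed.

Lemma ccont_sum (I : Type) (l : seq I) (F : I -> R -> Cplx R) t :
  (forall i, ccont (F i) t) -> ccont (fun r => \sum_(i <- l) F i r) t.
Proof.
move=> h; elim: l => [|i l ih].
  rewrite (_ : (fun _ => _) = fun=> 0); last by apply/funext => r; rewrite big_nil.
  by split => x; exact: cst_continuous.
rewrite (_ : (fun _ => _) = fun r => F i r - ((fun=> 0) r - \sum_(j <- l) F j r)).
  apply: ccontB => //; apply: ccontB => //.
  by split => x; exact: cst_continuous.
by apply/funext => r; rewrite big_cons sub0r opprK.
Qed.

Lemma gronwall (E dE : R -> R) (t K : R) : 0 <= K ->
  {within `[0, t], continuous E} ->
  (forall s, 0 < s < t -> is_derive s 1 E (dE s)) ->
  (forall s, 0 < s < t -> - K * E s <= dE s) ->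
  forall s, 0 <= s <= t -> expR (K * s) * E s <= expR (K * t) * E t.
Proof.
move=> K0 Ec Ed dEK s /andP[s0]; rewrite le_eqVlt => /predU1P[->//|st].
pose dF x := expR (K * x) * (K * E x + dE x).
have expd (x : R) : is_derive x 1 (fun x => expR (K * x)) (expR (K * x) * K).
  have i : is_derive x 1 (fun x => K * x) K.
    by have := @is_deriveZ _ _ _ (@id R) K x 1 1 (is_derive_id x 1);
      rewrite /GRing.scale/= mulr1.
  exact: (is_derive1_comp (is_derive_expR (K * x)) i).
have Fc : {within `[s, t], continuous (fun x => expR (K * x) * E x)}.
  move=> x; apply: cvgM.
    apply: continuous_subspaceT => {}x.
    by apply: differentiable_continuous; apply/derivable1_diffP; exact: ex_derive.
  move: x; apply: continuous_subspaceW Ec => x /=; rewrite !in_itv/=.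
  by move=> /andP[? ->]; rewrite andbT (le_trans s0).
have sub (x : R) : x \in `]s, t[ -> 0 < x < t.
  by rewrite in_itv/= => /andP[sx ->]; rewrite andbT (le_lt_trans s0).
have Fd (x : R) : x \in `]s, t[ ->
    is_derive x 1 (fun x => expR (K * x) * E x) (dF x).
  move=> /sub x0t; have h := is_deriveM (expd x) (Ed x x0t).
  by apply: is_derive_eq; rewrite /dF /GRing.scale/=; ring.
have [x /sub x0t h] := MVT st Fd Fc; rewrite -subr_ge0 h.
apply: mulr_ge0; last by rewrite subr_ge0 ltW.
by rewrite /dF mulr_ge0 ?expR_ge0//; have := dEK x x0t; lra.
Qed.

Lemma complex_gronwall A (v : R -> Cplx R) (t K b : R) : 0 <= K -> 0 <= b ->
  ccont A t ->
  (forall s, 0 < s < t -> cderiv A s (v s) /\ nc (v s) <= K * nc (A s) + b) ->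
  forall s, 0 <= s <= t ->
    nc (A s) <= expR ((2 * K + 1) * t) * (nc (A t) + b).
Proof.
move=> K0 b0 [c1 c2] Ad s st; set L := 2 * K + 1.
have L0 : 0 <= L by rewrite /L; lra.
pose E s := complex.Re (A s) * complex.Re (A s) + complex.Im (A s) * complex.Im (A s) + b ^+ 2.
pose dE s := 2 * (complex.Re (A s) * complex.Re (v s) + complex.Im (A s) * complex.Im (v s)).
have EE x : E x = nc (A x) ^+ 2 + b ^+ 2 by rewrite normc_sqr !expr2.
have t0 : 0 <= t by lra.
have := @gronwall E dE t L L0 _ _ _ s st.
have h1 : {within `[0, t], continuous E}.
  move=> x; apply: cvgD; last exact: cst_continuous.
  by apply: cvgD; apply: cvgM; [exact: c1|exact: c1|exact: c2|exact: c2].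
have h2 (x : R) : 0 < x < t -> is_derive x 1 E (dE x).
  move=> /Ad[[d1 d2] _].
  have h := is_deriveD (is_deriveD (is_deriveM d1 d1) (is_deriveM d2 d2))
    (is_derive_cst (b ^+ 2) x 1).
  by apply: is_derive_eq; rewrite /dE /GRing.scale/=; ring.
have h3 (x : R) : 0 < x < t -> - L * E x <= dE x.
  move=> /Ad[_]; rewrite EE /dE.
  set z := A x; set w := v x => hw.
  have CS : `|complex.Re z * complex.Re w + complex.Im z * complex.Im w| <= nc z * nc w.
    rewrite -ler_sqr ?nnegrE ?mulr_ge0 ?normc_ge0// exprMn !normc_sqr real_normK ?num_real//.
    have := sqr_ge0 (complex.Re z * complex.Im w - complex.Im z * complex.Re w); lra.
  move: CS; rewrite ler_norml => /andP[CS _].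
  have z0 := normc_ge0 z; have w0 := normc_ge0 w.
  have : nc z * nc w <= nc z * (K * nc z + b) by rewrite ler_wpM2l.
  have := sqr_ge0 (nc z - b); have : 0 <= K * b ^+ 2 by rewrite mulr_ge0 ?sqr_ge0.
  rewrite /L; lra.
move=> /(_ h1 h2 h3); rewrite !EE => h.
have q0 : 0 <= nc (A t) + b by rewrite addr_ge0 ?normc_ge0.
have e1 : 1 <= expR (L * t) by rewrite -expR0 ler_expR mulr_ge0.
have e2 : 1 <= expR (L * s) by rewrite -expR0 ler_expR mulr_ge0//; lra.
rewrite -ler_sqr ?nnegrE ?mulr_ge0 ?normc_ge0 ?expR_ge0// exprMn.
apply: (@le_trans _ _ (expR (L * t) * (nc (A t) ^+ 2 + b ^+ 2))).
  apply: le_trans h; apply: (@le_trans _ _ (nc (A s) ^+ 2 + b ^+ 2)).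
    by rewrite lerDl sqr_ge0.
  by rewrite ler_peMl// addr_ge0 ?sqr_ge0.
apply: ler_pM; rewrite ?expR_ge0 ?addr_ge0 ?sqr_ge0//.
  by rewrite expr2 ler_peMl// expR_ge0.
by have := mulr_ge0 (normc_ge0 (A t)) b0; lra.
Qed.

End complex_gronwall.

Section loewner_flow.
Context {R : realType}.
Local Notation nc := (@Normc.normc R).
Variables (lambda : R -> R) (t : R).

Lemma loewner_solution_Im (z : Cplx R) (y : R -> Cplx R) (s : R) :
  loewner_solution lambda t z y -> 0 <= s <= t ->
  `|complex.Im (y t)| <= `|complex.Im (y s)|.
Proof.
move=> [_ /continuous_ccont[_ yc] yd] st.
pose E s := - (complex.Im (y s) * complex.Im (y s)).
pose v s : Cplx R := 2 / (y s - (lambda s)%:C).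
pose dE s := - (2 * (complex.Im (y s) * complex.Im (v s))).
have h1 : {within `[0, t], continuous E}.
  by move=> x; apply: cvgN; apply: cvgM; exact: yc.
have h2 (x : R) : 0 < x < t -> is_derive x 1 E (dE x).
  move=> /yd[_ _ d]; have h := is_deriveN (is_deriveM d d).
  by apply: is_derive_eq; rewrite /dE /v /GRing.scale/=; ring.
have h3 (x : R) : 0 < x < t -> - 0 * E x <= dE x.
  move=> _; rewrite oppr0 mul0r /dE oppr_ge0 pmulr_rle0// /v.
  have -> : complex.Im (y x) = complex.Im (y x - (lambda x)%:C).
    by rewrite Cplx_ImB subr0.
  case: (y x - _) => a b; rewrite mulr_natl mulr2n Cplx_ImD /=.
  have := sqr_ge0 b; have : 0 <= (a ^+ 2 + b ^+ 2)^-1.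
    by rewrite invr_ge0 addr_ge0 ?sqr_ge0.
  move: (_^-1) => q q0 b0; have : 0 <= q * b ^+ 2 by exact: mulr_ge0.
  lra.
have := gronwall (lexx 0) h1 h2 h3 st.
rewrite !mul0r expR0 !mul1r /E lerN2 -!expr2 -[leLHS]real_normK ?num_real//.
by rewrite -[leRHS]real_normK ?num_real// ler_sqr.
Qed.

End loewner_flow.

Section flow_estimates.
Context {R : realType}.
Local Notation nc := (@Normc.normc R).
Variables (lambda : R -> R) (t eta : R).
Hypotheses (t_ge0 : 0 <= t) (eta_gt0 : 0 < eta).

Lemma normc_nat (n : nat) : nc n%:R = n%:R.
Proof. by rewrite normcMn Normc.normc1. Qed.

Let pole (y : R -> Cplx R) (s : R) : Cplx R := (y s - (lambda s)%:C)^-1.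

Definition loewner_flow (y : R -> Cplx R) : Prop :=
  (exists z, loewner_solution lambda t z y) /\ eta <= `|complex.Im (y t)|.

Let pole_bound y s : loewner_flow y -> 0 <= s <= t -> nc (pole y s) <= eta^-1.
Proof.
move=> [[z ysol] yt] st; rewrite Normc.normcV lef_pV2 ?posrE//.
  apply: (le_trans yt); apply: (le_trans (loewner_solution_Im ysol st)).
  rewrite (_ : complex.Im (y s) = complex.Im (y s - (lambda s)%:C)).
    exact: abs_Im_le_normc.
  by rewrite Cplx_ImB subr0.
apply: (@lt_le_trans _ _ `|complex.Im (y s - (lambda s)%:C)|).
  rewrite Cplx_ImB subr0 (lt_le_trans eta_gt0)// (le_trans yt)//.
  exact: (loewner_solution_Im ysol st).
exact: abs_Im_le_normc.
Qed.

Let pole_sub y0 y1 s : loewner_flow y0 -> loewner_flow y1 -> 0 < s < t ->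
  pole y1 s = pole y0 s - pole y0 s * pole y1 s * (y1 s - y0 s).
Proof.
move=> [[z0 [_ _ h0]] _] [[z1 [_ _ h1]] _] st; rewrite /pole.
have [n0 _ _] := h0 s st; have [n1 _ _] := h1 s st.
by field; rewrite !subr_eq0 n0 n1.
Qed.

Let flow_sub_cderiv y0 y1 s : loewner_flow y0 -> loewner_flow y1 -> 0 < s < t ->
  cderiv (fun s => y1 s - y0 s) s
    (- 2 * (pole y0 s * pole y1 s * (y1 s - y0 s))).
Proof.
move=> [[z0 [_ _ h0]] _] [[z1 [_ _ h1]] _] st; rewrite /pole.
have [n0 a0 b0] := h0 s st; have [n1 a1 b1] := h1 s st.
have -> : - 2 * ((y0 s - (lambda s)%:C)^-1 * (y1 s - (lambda s)%:C)^-1 * (y1 s - y0 s))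
    = 2 / (y1 s - (lambda s)%:C) - 2 / (y0 s - (lambda s)%:C) :> Cplx R.
  by field; rewrite !subr_eq0 n0 n1.
exact: cderivB.
Qed.

Let flow_sub_ccont y0 y1 : loewner_flow y0 -> loewner_flow y1 ->
  ccont (fun s => y1 s - y0 s) t.
Proof.
move=> [[z0 [_ c0 _]] _] [[z1 [_ c1 _]] _].
exact: (ccontB (continuous_ccont c1) (continuous_ccont c0)).
Qed.

Let K : R := 4 * eta^-1 ^+ 2.
Let M : R := expR ((2 * K + 1) * t).

Let K_ge0 : 0 <= K. Proof. by rewrite mulr_ge0// sqr_ge0. Qed.

Let pole2 y0 y1 s : loewner_flow y0 -> loewner_flow y1 -> 0 <= s <= t ->
  nc (pole y0 s * pole y1 s) <= eta^-1 ^+ 2.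
Proof.
move=> f0 f1 st; rewrite Normc.normcM expr2.
by apply: ler_pM; rewrite ?normc_ge0// pole_bound.
Qed.

Lemma flow_lipschitz y0 y1 s : loewner_flow y0 -> loewner_flow y1 -> 0 <= s <= t ->
  nc (y1 s - y0 s) <= M * nc (y1 t - y0 t).
Proof.
move=> f0 f1 st.
have := complex_gronwall K_ge0 (lexx 0) (flow_sub_ccont f0 f1) _ st.
move=> /(_ (fun s => - 2 * (pole y0 s * pole y1 s * (y1 s - y0 s)))).
rewrite addr0; apply => x xt; split; first exact: flow_sub_cderiv.
have xt' : 0 <= x <= t by case/andP: xt => ? ?; rewrite !ltW.
rewrite addr0 Normc.normcM normcN normc_nat Normc.normcM mulrA ler_wpM2r ?normc_ge0//.
apply: (@le_trans _ _ (2 * eta^-1 ^+ 2)); last by rewrite ler_wpM2r ?sqr_ge0// ler_nat.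
by rewrite ler_pM2l// pole2.
Qed.

(* With q_j = 1 / (y_j - lambda) and d_j = y_j - y_0, the identity
   q_j = q_0 - q_0 q_j d_j closes the system satisfied by the power sums
   sum_j d_j and sum_j d_j^2 up to terms of order d_j^3. *)
Lemma flow_power_sums (n : nat) : exists2 C : R, 0 <= C &
  forall (y0 : R -> Cplx R) (y : 'I_n -> R -> Cplx R) (r : R),
  loewner_flow y0 -> (forall j, loewner_flow (y j)) -> 0 <= r ->
  (forall j, nc (y j t - y0 t) <= r) ->
  \sum_(j < n) (y j t - y0 t) = 0 ->
  \sum_(j < n) (y j t - y0 t) * (y j t - y0 t) = 0 ->
  nc (\sum_(j < n) (y j 0 - y0 0)) <= C * r ^+ 3 /\
  nc (\sum_(j < n) (y j 0 - y0 0) * (y j 0 - y0 0)) <= C * r ^+ 3.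
Proof.
pose h := eta^-1; pose B := n%:R * (h * M ^+ 3).
have h0 : 0 <= h by rewrite invr_ge0 ltW.
have M0 : 0 <= M by exact: expR_ge0.
have B0 : 0 <= B by rewrite mulr_ge0// mulr_ge0// exprn_ge0.
pose C1 := M * (4 * h ^+ 2 * B).
have C10 : 0 <= C1 by rewrite !mulr_ge0// ?sqr_ge0.
pose C2 := M * (2 * h ^+ 3 * (C1 + B)).
have C20 : 0 <= C2 by rewrite mulr_ge0// mulr_ge0 ?addr_ge0// mulr_ge0// exprn_ge0.
exists (C1 + C2); first exact: addr_ge0.
move=> y0 y r f0 fy r0 yr S1 S2.
have r30 : 0 <= r ^+ 3 by exact: exprn_ge0.
pose d j s := y j s - y0 s; pose q j s := pole (y j) s; pose p s := pole y0 s.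
have dj s j : 0 <= s <= t -> nc (d j s) <= M * r.
  by move=> st; rewrite (le_trans (flow_lipschitz f0 (fy j) st))// ler_wpM2l// yr.
have cub s : 0 <= s <= t -> nc (\sum_j q j s * d j s ^+ 3) <= B * r ^+ 3.
  move=> st; apply: (le_trans (normc_sum _ _)).
  rewrite (_ : B * r ^+ 3 = \sum_(j < n) (h * (M * r) ^+ 3)); last first.
    by rewrite sumr_const card_ord -mulr_natl /B exprMn; ring.
  apply: ler_sum => j _; rewrite Normc.normcM; apply: ler_pM; rewrite ?normc_ge0//.
    exact: pole_bound.
  rewrite !exprS expr0 !mulr1 !Normc.normcM.
  by do 2?[apply: ler_pM; rewrite ?mulr_ge0 ?normc_ge0 ?dj//].
have pb s : 0 <= s <= t -> nc (p s) <= h by move=> st; exact: pole_bound.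
have p2b s : 0 <= s <= t -> nc (p s * p s) <= h ^+ 2 by move=> st; exact: pole2.
have in_cc s : 0 < s < t -> 0 <= s <= t by case/andP => ? ?; rewrite !ltW.
have qE j s : 0 < s < t -> q j s = p s - p s * q j s * d j s.
  by move=> st; exact: pole_sub.
have dd j s : 0 < s < t -> cderiv (d j) s (- 2 * (p s * q j s * d j s)).
  by move=> st; exact: flow_sub_cderiv.
have dc j : ccont (d j) t by exact: flow_sub_ccont.
have Qbd s : 0 <= s <= t -> nc (\sum_j d j s * d j s) <= C1 * r ^+ 3.
  have b0 : 0 <= 4 * h ^+ 2 * B * r ^+ 3 by rewrite !mulr_ge0// sqr_ge0.
  move=> st; have := complex_gronwall K_ge0 b0 (ccont_sum (index_enum 'I_n)
    (fun j => ccontM (dc j) (dc j))) _ st.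
  move=> /(_ (fun s => \sum_j (d j s * (- 2 * (p s * q j s * d j s)) +
     - 2 * (p s * q j s * d j s) * d j s))) hQ.
  rewrite (_ : C1 * r ^+ 3 =
      M * (nc (\sum_j d j t * d j t) + 4 * h ^+ 2 * B * r ^+ 3)); last first.
    by rewrite /d S2 Normc.normc0 add0r /C1; ring.
  apply: hQ.
  move=> x xt; split; first by apply: cderiv_sum => j; apply: cderivM; exact: dd.
  rewrite (_ : \sum_j _ = - 4 * (p x * p x) * (\sum_j d j x * d j x)
    + 4 * (p x * p x) * \sum_j q j x * d j x ^+ 3); last first.
    rewrite !mulr_sumr -big_split/=; apply: eq_bigr => j _.
    move: (q j x) (p x) (d j x) (qE j x xt) => a b c E.
    have E' : b * a * c = b - a by rewrite {2}E; ring.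
    ring: E'.
  have xt' := in_cc x xt.
  apply: (le_trans (le_normcD _ _)); rewrite ![in leLHS]Normc.normcM normcN !normc_nat.
  rewrite -!Normc.normcM; apply: lerD.
    by rewrite ler_wpM2r ?normc_ge0// ler_wpM2l// p2b.
  rewrite -(mulrA (4 * h ^+ 2)); apply: ler_pM; rewrite ?mulr_ge0 ?normc_ge0//.
    by rewrite ler_wpM2l// p2b.
  exact: cub.
have t0 : 0 <= (0 : R) <= t by rewrite lexx.
split; last first.
  by rewrite mulrDl (le_trans (Qbd 0 t0))// lerDl; exact: mulr_ge0.
have b0 : 0 <= 2 * h ^+ 3 * (C1 + B) * r ^+ 3.
  by rewrite !mulr_ge0 ?addr_ge0// exprn_ge0.
have := complex_gronwall K_ge0 b0 (ccont_sum (index_enum 'I_n) dc) _ t0.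
move=> /(_ (fun s => \sum_j (- 2 * (p s * q j s * d j s)))) hS.
rewrite mulrDl; apply: (@le_trans _ _ (C2 * r ^+ 3)); last first.
  by rewrite lerDr; exact: mulr_ge0.
rewrite (_ : C2 * r ^+ 3 =
    M * (nc (\sum_j d j t) + 2 * h ^+ 3 * (C1 + B) * r ^+ 3)); last first.
  by rewrite /d S1 Normc.normc0 add0r /C2; ring.
apply: hS.
move=> x xt; split; first by apply: cderiv_sum => j; exact: dd.
rewrite (_ : \sum_j _ = - 2 * (p x * p x) * (\sum_j d j x)
  + (2 * (p x * p x * p x) * (\sum_j d j x * d j x)
  - 2 * (p x * p x * p x) * \sum_j q j x * d j x ^+ 3)); last first.
  rewrite !mulr_sumr -sumrB -big_split/=; apply: eq_bigr => j _.
  move: (q j x) (p x) (d j x) (qE j x xt) => a b c E.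
  have E' : b * a * c = b - a by rewrite {2}E; ring.
  ring: E'.
have xt' := in_cc x xt.
have p3 : nc (p x * p x * p x) <= h ^+ 3.
  rewrite exprSr Normc.normcM; apply: ler_pM; rewrite ?normc_ge0//.
    exact: p2b.
  exact: pb.
apply: (le_trans (le_normcD _ _)); apply: lerD.
  rewrite !Normc.normcM normcN !normc_nat -!Normc.normcM.
  rewrite ler_wpM2r ?normc_ge0//; apply: (@le_trans _ _ (2 * h ^+ 2)).
    by rewrite ler_wpM2l// p2b.
  by rewrite /K ler_wpM2r ?sqr_ge0// ler_nat.
apply: (le_trans (le_normcD _ _)); rewrite normcN mulrDr mulrDl.
apply: lerD; rewrite Normc.normcM [nc (2 * _)]Normc.normcM normc_nat -(mulrA (2 * h ^+ 3)).
  apply: ler_pM; rewrite ?mulr_ge0 ?normc_ge0//; last exact: Qbd.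
  by rewrite ler_wpM2l.
apply: ler_pM; rewrite ?mulr_ge0 ?normc_ge0//; last exact: cub.
by rewrite ler_wpM2l.
Qed.

End flow_estimates.

(** * Transport to the half-plane *)

Lemma slit_domain_nbhs {R : realType} (c : R -> Cplx R) (z : Cplx R) :
  slit_arc c -> slit_domain c z -> nbhs z (slit_domain c).
Proof.
move=> [cc _ _ _] [zH zc].
have Kc : compact (arc_image c).
  by apply: continuous_compact => //; exact: segment_compact.
have Kcl : closed (arc_image c) by apply: compact_closed => //; exact: norm_hausdorff.
have := open_nbhs_nbhs (conj (closed_openC Kcl) zc).
apply: filterS2; last first.
  apply/nbhs_Cplx_box; exists (complex.Im z) => //.
  move=> x y _; instantiate (1 := @upper_half_plane R).
  rewrite /upper_half_plane/= ltr_norml; lra.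
by move=> z' [].
Qed.

Section pullback.
Context {R : realType}.
Local Notation nc := (@Normc.normc R).
Variables (lambda : R -> R) (t : R) (c : R -> Cplx R).
Variables (f : Cplx R -> R -> Cplx R) (g : Cplx R -> Cplx R) (w : Cplx R -> R).
Hypotheses (t_gt0 : 0 < t) (c_arc : slit_arc c).
Hypothesis f_loewner : forall z : Cplx R,
  0 <= complex.Im z -> ~ arc_image c z -> loewner_solution lambda t z (f z).
Hypothesis g_onto : forall z : Cplx R, upper_half_plane z ->
  slit_domain c (g z) /\ f (g z) t = z.
Hypothesis w_harmonic : harmonic_on (slit_domain c) w.

Let flow (eta : R) (z : Cplx R) : 0 < eta -> eta <= complex.Im z ->
  loewner_flow lambda t eta (f (g z)).
Proof.
move=> e0 ez; have z0 : upper_half_plane z by exact: lt_le_trans ez.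
have [[gH gc] fg] := g_onto z0; split.
  by exists (g z); apply: f_loewner => //; exact: ltW.
by rewrite fg (le_trans ez)// ler_norm.
Qed.

Let flow0 (z : Cplx R) : upper_half_plane z -> f (g z) 0 = g z.
Proof.
by move=> z0; have [[gH gc] _] := g_onto z0; have [] := f_loewner (ltW gH) gc.
Qed.

Let g_lipschitz (eta : R) : 0 < eta -> exists2 M : R, 0 < M &
  forall z1 z2, eta <= complex.Im z1 -> eta <= complex.Im z2 ->
    nc (g z1 - g z2) <= M * nc (z1 - z2).
Proof.
move=> e0; exists (expR ((2 * (4 * eta^-1 ^+ 2) + 1) * t)); first exact: expR_gt0.
move=> z1 z2 h1 h2.
have u1 : upper_half_plane z1 by exact: lt_le_trans h1.
have u2 : upper_half_plane z2 by exact: lt_le_trans h2.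
have st : 0 <= (0 : R) <= t by rewrite lexx ltW.
have := flow_lipschitz e0 (flow e0 h2) (flow e0 h1) st.
by rewrite !flow0// (g_onto u1).2 (g_onto u2).2.
Qed.

Let pullback_taylor (z : Cplx R) : upper_half_plane z ->
  exists l1 l2 q1 q2 : R, forall e, 0 < e -> exists2 d : R, 0 < d &
  forall z', nc (g z' - g z) < d ->
    `|w (g z') - w (g z)
       - (complex.Re (g z' - g z) * l1 + complex.Im (g z' - g z) * l2)
       - (q1 * complex.Re ((g z' - g z) * (g z' - g z)) +
          q2 * complex.Im ((g z' - g z) * (g z' - g z)))|
      <= e * (2 * nc (g z' - g z)) ^+ 2.
Proof.
move=> zH; have [Dz _] := g_onto zH.
have := slit_domain_nbhs c_arc Dz; case E : (g z) => [a b] Dab.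
have [l1 [l2 [q1 [q2 H]]]] := harmonic_taylor w_harmonic Dab.
exists l1, l2, q1, q2 => e e0; have [d d0 hd] := H e e0; exists d => // z' z'd.
case E' : (g z') z'd => [a' b'] z'd.
have h1 := abs_Re_le_normc ((a' +i* b') - (a +i* b) : Cplx R).
have h2 := abs_Im_le_normc ((a' +i* b') - (a +i* b) : Cplx R).
have := hd (a' - a) (b' - b) (le_lt_trans h1 z'd) (le_lt_trans h2 z'd).
rewrite (addrC a (_ - _)) (addrC b (_ - _)) !subrK => hh.
apply: (@le_trans _ _ (e * (`|a' - a| + `|b' - b|) ^+ 2)); last first.
  rewrite ler_pM2l// ler_sqr ?nnegrE ?addr_ge0 ?mulr_ge0 ?normc_ge0//.
  by rewrite mulr_natl mulr2n lerD.
apply: le_trans hh; rewrite le_eqVlt; apply/predU1P; left; congr (`|_|).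
by rewrite /=; ring.
Qed.

Lemma pullback_continuous (x y : R) : 0 < y ->
  {for (x, y), continuous (fun z : R * R => w (g (z.1 +i* z.2)))}.
Proof.
move=> y0; have y20 : 0 < y / 2 by lra.
have [M M0 hM] := g_lipschitz y20.
have [l1 [l2 [q1 [q2 H]]]] := pullback_taylor (y0 : upper_half_plane (x +i* y : Cplx R)).
have [d d0 hd] := H 1 ltr01.
pose L := `|l1| + `|l2| + `|q1| + `|q2| + 4.
have L0 : 0 < L by rewrite /L ltr_wpDl// !addr_ge0.
have FF : Filter (nbhs (x, y)) by exact: nbhs_filter.
apply/cvgrPdist_le => e e0; rewrite [nbhs _]/=.
pose rho := Num.min (y / 2) (Num.min (d / (2 * M)) (Num.min (1 / (2 * M)) (e / (2 * M * L)))).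
have M20 : 0 < 2 * M by lra.
have rho0 : 0 < rho by rewrite !lt_min y20 !divr_gt0// mulr_gt0.
near=> z.
have [z1 z2] : `|z.1 - x| < rho /\ `|z.2 - y| < rho by near: z; exact: near_box.
have rho2 : [/\ rho <= y / 2, rho <= d / (2 * M), rho <= 1 / (2 * M)
    & rho <= e / (2 * M * L)].
  by split; rewrite /rho !ge_min lexx ?orbT.
case: rho2 => r1; rewrite !ler_pdivlMr ?mulr_gt0// => r2 r3 r4.
have zy : y / 2 <= z.2 by move: z2; rewrite ltr_norml; lra.
have := hM (z.1 +i* z.2) (x +i* y) zy ltac:(rewrite /=; lra).
set n := nc (g _ - g _) => nM.
have n1 : n < rho * (2 * M).
  apply: (le_lt_trans nM); rewrite (mulrC rho) -mulrA mulrCA ltr_pM2l//.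
  by apply: le_lt_trans (normc_le_abs _) _ => /=; lra.
have n0 : 0 <= n by exact: normc_ge0.
have nd : n < d by exact: lt_le_trans r2.
have n2 : n <= 1 by lra.
have nn : n ^+ 2 <= n by rewrite expr2 ler_piMl.
have := hd (z.1 +i* z.2) nd; rewrite mul1r -/n.
set D := g _ - g _ => hh.
have a1 := abs_Re_le_normc D; have a2 := abs_Im_le_normc D.
have a3 := abs_Re_le_normc (D * D); have a4 := abs_Im_le_normc (D * D).
rewrite Normc.normcM -/n in a3 a4; rewrite -/n in a1 a2.
have b1 : `|complex.Re D * l1| <= n * `|l1| by rewrite normrM ler_wpM2r.
have b2 : `|complex.Im D * l2| <= n * `|l2| by rewrite normrM ler_wpM2r.
have b3 : `|q1 * complex.Re (D * D)| <= `|q1| * n.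
  by rewrite normrM ler_wpM2l// (le_trans a3)// -expr2.
have b4 : `|q2 * complex.Im (D * D)| <= `|q2| * n.
  by rewrite normrM ler_wpM2l// (le_trans a4)// -expr2.
have nL : n * L <= e.
  apply: le_trans r4; rewrite -(mulrA 2) mulrA (mulrA rho) mulrA.
  by rewrite ler_pM2r// -mulrA ltW.
move: hh b1 b2 b3 b4; rewrite distrC.
move: (w _) (w _) (_ * l1) (_ * l2) (q1 * _) (q2 * _) => w1 w2 c1 c2 c3 c4.
rewrite !ler_norml; move: nL nn; rewrite /L exprMn.
have -> : 2 ^+ 2 = 4 :> R by rewrite expr2; lra.
lra.
Unshelve. all: by end_near. Qed.

Lemma pullback_mean_harmonic (x y : R) : 0 < y ->
  mean_harmonic_at (fun x y => w (g (x +i* y))) x y.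
Proof.
move=> y0 e e0; have y20 : 0 < y / 2 by lra.
have [M M0 hM] := g_lipschitz y20.
have [C C0 hC] := @flow_power_sums R lambda t (y / 2) (ltW t_gt0) y20 4.
set z : Cplx R := x +i* y.
have zH : upper_half_plane z by [].
have [l1 [l2 [q1 [q2 H]]]] := pullback_taylor zH.
pose e' := e / (32 * M ^+ 2).
have e'0 : 0 < e' by rewrite divr_gt0// mulr_gt0// exprn_gt0.
have e'E : e' * (32 * M ^+ 2) = e.
  by rewrite divfK// mulf_neq0// ?expf_neq0// gt_eqF.
have [d d0 hd] := H e' e'0.
pose L := (`|l1| + `|l2| + `|q1| + `|q2|) * C.
have L0 : 0 <= L by rewrite mulr_ge0// !addr_ge0.
near=> r.
have r0 : 0 < r by near: r; exact: nbhs_right_gt.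
have ry : r < y / 2 by near: r; exact: nbhs_right_lt.
have rd : r < d / M by near: r; apply: nbhs_right_lt; exact: divr_gt0.
have rL : r < e / (2 * (L + 1)) by near: r; apply: nbhs_right_lt; rewrite divr_gt0//; lra.
pose p (j : 'I_4) : Cplx R := nth 0
  [:: (x + r) +i* y; (x - r) +i* y; x +i* (y + r); x +i* (y - r)] j.
pose s (j : 'I_4) : Cplx R := nth 0 [:: r +i* 0; (- r) +i* 0; 0 +i* r; 0 +i* (- r)] j.
have pz j : p j - z = s j.
  by case: j => [[|[|[|[|//]]]] ?]; apply/eqP; rewrite eq_complex/=;
    apply/andP; split; apply/eqP; ring.
have pIm j : y / 2 <= complex.Im (p j).
  by case: j => [[|[|[|[|//]]]] ?] /=; lra.
have pH j : upper_half_plane (p j) by rewrite /upper_half_plane/=; have := pIm j; lra.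
have sr j : nc (s j) = r.
  by case: j => [[|[|[|[|//]]]] ?] /=;
    rewrite ?sqrrN ?(expr0n, addr0, add0r)/= ?addr0 ?add0r sqrtr_sqr gtr0_norm.
have s1 : \sum_j s j = 0.
  by rewrite !big_ord_recr big_ord0 /s/= add0r; apply/eqP; rewrite eq_complex/=;
    apply/andP; split; apply/eqP; ring.
have s2 : \sum_j s j * s j = 0.
  by rewrite !big_ord_recr big_ord0 /s/= add0r; apply/eqP; rewrite eq_complex/=;
    apply/andP; split; apply/eqP; ring.
have zp j : f (g (p j)) t - f (g z) t = s j.
  by rewrite (g_onto (pH j)).2 (g_onto zH).2 pz.
have zy : y / 2 <= complex.Im z by rewrite /=; lra.
have [] := hC (f (g z)) (fun j => f (g (p j))) r (flow y20 zy)
  (fun j => flow y20 (pIm j)) (ltW r0).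
- by move=> j; rewrite zp sr.
- by under eq_bigr do rewrite zp.
- by under eq_bigr do rewrite zp.
under eq_bigr do rewrite !flow0//.
under [X in _ -> nc X <= _ -> _]eq_bigr do rewrite !flow0//.
pose D j := g (p j) - g z; rewrite -/(D _) => hS hQ.
have Dr j : nc (D j) <= M * r by rewrite -(sr j) -pz; exact: hM.
have Dd j : nc (D j) < d.
  by apply: (le_lt_trans (Dr j)); rewrite mulrC -ltr_pdivlMr.
pose a j := w (g (p j)) - w (g z) - (complex.Re (D j) * l1 + complex.Im (D j) * l2)
  - (q1 * complex.Re (D j * D j) + q2 * complex.Im (D j * D j)).
have aj j : `|a j| <= e / 8 * r ^+ 2.
  apply: (le_trans (hd _ (Dd j))); apply: (@le_trans _ _ (e' * (2 * (M * r)) ^+ 2)).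
    apply: ler_wpM2l; first exact: ltW.
    have h2 : 2 * nc (D j) <= 2 * (M * r) by rewrite ler_pM2l.
    have h3 : 0 <= 2 * nc (D j) by rewrite mulr_ge0// normc_ge0.
    by rewrite ler_sqr ?nnegrE// (le_trans h3).
  by rewrite -e'E le_eqVlt; apply/predU1P; left; field.
pose S := \sum_j D j; pose Q := \sum_j D j * D j.
have ReS : complex.Re S = \sum_j complex.Re (D j) by exact: (big_morph _ Cplx_ReD).
have ImS : complex.Im S = \sum_j complex.Im (D j) by exact: (big_morph _ Cplx_ImD).
have ReQ : complex.Re Q = \sum_j complex.Re (D j * D j) by exact: (big_morph _ Cplx_ReD).
have ImQ : complex.Im Q = \sum_j complex.Im (D j * D j) by exact: (big_morph _ Cplx_ImD).
have -> : cross_diff (fun x y => w (g (x +i* y))) x y r =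
    \sum_j a j + (complex.Re S * l1 + complex.Im S * l2
      + (q1 * complex.Re Q + q2 * complex.Im Q)).
  rewrite ReS ImS ReQ ImQ !mulr_suml !mulr_sumr -!big_split/=.
  rewrite (eq_bigr (fun j => w (g (p j)) - w (g z))); last first.
    have alg (w1 u v : R) : w1 - u - v + (u + v) = w1 by ring.
    by move=> j _; exact: alg.
  rewrite !big_ord_recr big_ord0 /= add0r /cross_diff /p /z /=; ring.
have r30 : 0 <= r ^+ 3 by rewrite exprn_ge0// ltW.
have sa : `|\sum_j a j| <= e / 2 * r ^+ 2.
  apply: (le_trans (ler_norm_sum _ _ _)).
  apply: (@le_trans _ _ (\sum_(j < 4) e / 8 * r ^+ 2)); first exact: ler_sum.
  by rewrite sumr_const card_ord -mulr_natl le_eqVlt; apply/predU1P; left; field.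
have b1 : `|complex.Re S * l1| <= C * r ^+ 3 * `|l1|.
  by rewrite normrM ler_wpM2r// (le_trans (abs_Re_le_normc _)).
have b2 : `|complex.Im S * l2| <= C * r ^+ 3 * `|l2|.
  by rewrite normrM ler_wpM2r// (le_trans (abs_Im_le_normc _)).
have b3 : `|q1 * complex.Re Q| <= `|q1| * (C * r ^+ 3).
  by rewrite normrM ler_wpM2l// (le_trans (abs_Re_le_normc _)).
have b4 : `|q2 * complex.Im Q| <= `|q2| * (C * r ^+ 3).
  by rewrite normrM ler_wpM2l// (le_trans (abs_Im_le_normc _)).
have rLe : L * r ^+ 3 <= e / 2 * r ^+ 2.
  rewrite exprS mulrA ler_wpM2r ?sqr_ge0//.
  by rewrite ltr_pdivlMr in rL; nra.
apply: (le_trans (ler_normD _ _)); apply: (@le_trans _ _ (e / 2 * r ^+ 2 + L * r ^+ 3)).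
  apply: lerD => //; apply: (le_trans (ler_normD _ _)).
  apply: (le_trans (lerD (ler_normD _ _) (ler_normD _ _))).
  by apply: (le_trans (lerD (lerD b1 b2) (lerD b3 b4))); rewrite /L; lra.
lra.
Unshelve. all: by end_near. Qed.

End pullback.

Section prime_end_limits.
Context {R : realType}.
Implicit Types (D : set (Cplx R)) (F : set_system (Cplx R)) (h : Cplx R -> Cplx R).

Lemma prime_end_meet D F (A B : set (Cplx R)) : prime_end D F -> F A -> F B ->
  exists z, A z /\ B z.
Proof.
move=> [c [V [[_ comp dec _ _] ->]]] [m mA] [n nB].
have mono i j : (i <= j)%N -> V j `<=` V i.
  move=> /subnK <-; elim: (j - i)%N => [|k ih] //=.
  by apply: subset_trans ih; exact: dec.
have [z Dz Vz] := comp (maxn m n).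
have zV : V (maxn m n) z by rewrite Vz; exact: connected_component_refl.
exists z; split; [apply: mA|apply: nB].
  exact: (mono m (maxn m n) (leq_maxl _ _)).
exact: (mono n (maxn m n) (leq_maxr _ _)).
Qed.

Lemma nbhs_half_plane_end (p : R) : half_plane_end (Some p) --> (p%:C : Cplx R).
Proof. by move=> A pA; apply: filterS (pA : nbhs (p%:C : Cplx R) A) => z Az _. Qed.

Lemma prime_end_limit_unique D h F (e : option R) (x : R) : prime_end D F ->
  h @ F --> half_plane_end e -> h @ F --> (x%:C : Cplx R) -> e = Some x.
Proof.
move=> DF he hx; apply: contrapT => ex.
suff [A [B [eA xB AB]]] : exists A B : set (Cplx R),
    [/\ half_plane_end e A, nbhs (x%:C : Cplx R) B & forall z, A z -> B z -> False].
  have [z [Az Bz]] := prime_end_meet DF (he A eA) (hx B xB).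
  exact: AB Az Bz.
case: e he ex => [p|] _ ex.
  have px : 0 < `|p - x| / 2.
    by rewrite divr_gt0// normr_gt0 subr_eq0; apply: contra_notN ex => /eqP ->.
  exists [set z | `|complex.Re z - p| < `|p - x| / 2],
    [set z | `|complex.Re z - x| < `|p - x| / 2]; split.
  - apply: nbhs_half_plane_end; apply/nbhs_Cplx_box.
    by exists (`|p - x| / 2) => // a b.
  - by apply/nbhs_Cplx_box; exists (`|p - x| / 2) => // a b.
  move=> z /= h1 h2; have := ler_normD (p - complex.Re z) (complex.Re z - x).
  by rewrite addrA subrK (distrC p (complex.Re z)); lra.
exists [set z | `|x| + 2 < Normc.normc z],
  [set z | `|complex.Re z - x| < 1 /\ `|complex.Im z| < 1]; split.
- by exists (`|x| + 2).
- apply/nbhs_Cplx_box; exists 1 => // a b /= ? hb; split => //.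
  by rewrite subr0 in hb.
move=> z /= h1 [h2 h3]; have := normc_le_abs z.
have := ler_normD (complex.Re z - x) x; rewrite subrK; lra.
Qed.

End prime_end_limits.

Section slit_harmonic_measure.
Context {R : realType}.
Variables (lambda : R -> R) (t : R) (c : R -> Cplx R).
Variables (f : Cplx R -> R -> Cplx R) (g : Cplx R -> Cplx R).
Hypotheses (t_gt0 : 0 < t) (c_arc : slit_arc c).
Hypothesis f_loewner : forall z : Cplx R,
  0 <= complex.Im z -> ~ arc_image c z -> loewner_solution lambda t z (f z).
Hypothesis f_conformal :
  conformal_onto (slit_domain c) (@upper_half_plane R) (f^~ t) g.
Hypothesis f_extends : extends_to_prime_ends (slit_domain c) (f^~ t) g.

Lemma slit_harmonic_measure (a b m : R) (s : seq R) (X : set (set_system (Cplx R))) :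
  a <= b -> a \in s -> b \in s ->
  X `<=` prime_end_preimage (slit_domain c) (f^~ t) [set` s] ->
  is_harmonic_measure (slit_domain c)
    (prime_end_preimage (slit_domain c) (f^~ t) `[a, b]) X (g (0 +i* 1)) m ->
  m = (atan b - atan a) / pi.
Proof.
move=> ab as_ bs Xs [w [wh [M wM] wlim ->]].
have [_ _ g_onto] := f_conformal.
have [_ fex gex] := f_extends.
set E := prime_end_preimage _ _ _ in wlim.
pose B (e : option R) : bool := if e is Some x then (a <= x <= b)%R else false.
have lim_at (e : option R) : (forall x, e = Some x -> x \notin s) ->
    exists v : R, (forall d, 0 < d ->
      half_plane_end e [set z | `|w (g z) - v| < d]) /\
      v = (B e)%:R.
  move=> es; have [F DF Fe] := fex e.
  have XF : ~ X F.
    move=> /Xs[_ [x xs Fx]].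
    by have /es := prime_end_limit_unique DF Fe Fx; rewrite xs.
  exists (\1_E F); split.
    move=> d d0.
    have h1 : nbhs (\1_E F : R) [set r | `|r - \1_E F| < d].
      exists d => // r; by rewrite /ball/= distrC.
    have h2 : F [set z | `|w z - \1_E F| < d] := wlim F DF XF _ h1.
    exact: gex F e DF Fe _ h2.
  suff EF : (F \in E) = B e by rewrite indicE EF.
  rewrite /B; case: e es Fe => [x|] es Fe.
    apply/idP/idP => [|xab].
      rewrite inE => -[_ [x' x'ab Fx']].
      have [->] := prime_end_limit_unique DF Fe Fx'.
      by move: x'ab; rewrite /= in_itv.
    rewrite inE; split => //; exists x; first by rewrite /= in_itv.
    by move=> A xA; apply: Fe; exact: nbhs_half_plane_end.
  apply/negbTE; rewrite notin_setE => -[_ [x' _ Fx']].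
  by have := prime_end_limit_unique DF Fe Fx'.
have := @half_plane_harmonic_measure R (fun x y => w (g (x +i* y))) a b s ab as_ bs.
move=> -> //.
- by rewrite !subr0 !divr1.
- by move=> x y y0; exact: (pullback_continuous t_gt0 c_arc f_loewner g_onto wh).
- by move=> x y y0; exact: (pullback_mean_harmonic t_gt0 c_arc f_loewner g_onto wh).
- by exists M => x y y0; apply: wM; have [] := g_onto (x +i* y) y0.
- move=> p ps e e0; have [|v [hv vE]] := lim_at (Some p); first by move=> x [<-].
  have /nbhs_Cplx_box[d d0 hd] : nbhs (p%:C : Cplx R)
      [set z | upper_half_plane z -> `|w (g z) - v| < e] by exact: hv.
  exists d => // x y y0 xp yd; rewrite -vE ltW//; apply: hd => //.
  by rewrite subr0 gtr0_norm.
- move=> e e0; have [//|v [hv vE]] := lim_at None.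
  have [K hK] := hv e e0; exists K => x y y0 xy.
  have := hK (x +i* y); rewrite /= vE subr0 => h; apply/ltW/h => //.
  case: xy => [xK|yK].
    by apply: (lt_le_trans xK); exact: abs_Re_le_normc (x +i* y).
  apply: (lt_le_trans yK); apply: le_trans (abs_Im_le_normc (x +i* y)).
  exact: ler_norm.
Qed.

End slit_harmonic_measure.

Theorem theorem2 (R : realType) (T : R)
    (gamma : R -> R -> Cplx R)
    (f finv : Cplx R -> R -> Cplx R)
    (f1 f2 m1 m2 : R -> R)
    (T_gt0 : 0 < T)
    (gamma_arc : forall t, 0 < t < T -> slit_arc (gamma t))
    (f_loewner : forall t, 0 < t < T -> forall z : Cplx R,
       0 <= complex.Im z -> ~ arc_image (gamma t) z ->
       loewner_solution cbrt t z (f z))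
    (f_conformal : forall t, 0 < t < T ->
       conformal_onto (slit_domain (gamma t)) (@upper_half_plane R)
         (f^~ t) (finv^~ t))
    (f1_singular : singular_solution cbrt T f1)
    (f2_singular : singular_solution cbrt T f2)
    (f2_lt_f1 : forall t, 0 < t < T -> f2 t < cbrt t < f1 t)
    (f_extends : forall t, 0 < t < T ->
       extends_to_prime_ends (slit_domain (gamma t)) (f^~ t) (finv^~ t))
    (f_tip : forall t, 0 < t < T ->
       prime_ends_over (slit_domain (gamma t)) (gamma t 1) `<=`
       prime_end_preimage (slit_domain (gamma t)) (f^~ t) [set cbrt t])
    (f_base : forall t, 0 < t < T ->
       prime_ends_over (slit_domain (gamma t)) 0 `<=`
       prime_end_preimage (slit_domain (gamma t)) (f^~ t) [set f1 t; f2 t])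
    (m1_def : forall t, 0 < t < T ->
       is_harmonic_measure (slit_domain (gamma t))
         (prime_end_preimage (slit_domain (gamma t)) (f^~ t)
            `[cbrt t, f1 t])
         (prime_ends_over (slit_domain (gamma t)) 0 `|`
          prime_ends_over (slit_domain (gamma t)) (gamma t 1))
         (finv (0 +i* 1) t) (m1 t))
    (m2_def : forall t, 0 < t < T ->
       is_harmonic_measure (slit_domain (gamma t))
         (prime_end_preimage (slit_domain (gamma t)) (f^~ t)
            `[f2 t, cbrt t])
         (prime_ends_over (slit_domain (gamma t)) 0 `|`
          prime_ends_over (slit_domain (gamma t)) (gamma t 1))
         (finv (0 +i* 1) t) (m2 t)) :
  m1 t / (m2 t) ^+ 2 @[t --> 0^'+] --> (6 * pi : R).
Proof.
have exceptional (t : R) : 0 < t < T ->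
    prime_ends_over (slit_domain (gamma t)) 0 `|`
      prime_ends_over (slit_domain (gamma t)) (gamma t 1) `<=`
    prime_end_preimage (slit_domain (gamma t)) (f^~ t)
      [set` [:: cbrt t; f1 t; f2 t]].
  move=> tT F [/(f_base _ tT)|/(f_tip _ tT)] [DF [x xs Fx]]; split => //;
    exists x => //; rewrite /= !inE.
    by case: xs => ->; rewrite eqxx ?orbT.
  by rewrite xs eqxx.
apply: (@angle_ratio_cvg R T f1 f2) => // t tT;
  have /andP[t0 _] := tT; have /andP[f2t f1t] := f2_lt_f1 _ tT.
- apply: (slit_harmonic_measure t0 (gamma_arc _ tT) (f_loewner _ tT) (f_conformal _ tT)
    (f_extends _ tT) (ltW f1t) _ _ (exceptional t tT) (m1_def _ tT));
    by rewrite !inE eqxx ?orbT.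
- apply: (slit_harmonic_measure t0 (gamma_arc _ tT) (f_loewner _ tT) (f_conformal _ tT)
    (f_extends _ tT) (ltW f2t) _ _ (exceptional t tT) (m2_def _ tT));
    by rewrite !inE eqxx ?orbT.
Qed.
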